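(* Let $H$ be a graph with $e(H)\ge2$ and let $\alpha>0$. There exists $c>0$ such that for $n$ sufficiently large and $M\ge cn^{2-1/m(H)}$, if $G=G(n,M,H)$ is chosen at random, then $$\mathbb{P}\left(G\text{ is }\Big(H,\frac1c,\frac{M}{n^2}\Big)\text{-regular and } i_H(G)\le\frac1c\,n^{v(H)}\Big(\frac{M}{n^2}\Big)^{e(H)}\right)\le\alpha^M .$$
   Context: $v(\cdot)$, $e(\cdot)$ denote numbers of vertices and edges. For a graph $H$ with $e(H)\ge2$, $$m(H)=\max_{H'\subset H,\ e(H')>1}\frac{e(H')-1}{v(H')-2}.$$ Let $H$ be a graph on vertex set $[h]=\{1,\dots,h\}$. Let $V_1,\ldots,V_h$ be a partition of $[N]=[hn]$ with $|V_i|=n$ for each $i$. For a graph $G$ and $U,W\subset V(G)$, $e_G(U,W)$ is the number of edges of $G$ with one vertex in $U$ and one in $W$, and $d_G(U,W)=e_G(U,W)/(|U||W|)$. For $0<\eta,p\le1$, the pair $(U,W)$ is $(\eta,p)$-regular if for every $U'\subset U$ with $|U'|\ge\eta|U|$ and $W'\subset W$ with $|W'|\ge\eta|W|$, $|d_G(U',W')-d_G(U,W)|\le\eta p$. A graph $G$ on $[N]$ is $(H,\eta,p)$-regular if for every $\{i,j\}\in E(H)$ the pair $(V_i,V_j)$ is $(\eta,p)$-regular in $G$. A canonical copy of $H$ in $G$ is a set of vertices $v_1,\ldots,v_h$ with $v_i\in V_i$ such that $\{v_i,v_j\}$ is an edge of $G$ whenever $\{i,j\}\in E(H)$; $i_H(G)$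 is the number of canonical copies of $H$ in $G$. $G(n,M,H)$ is a graph chosen uniformly at random from all $h$-partite graphs with parts $V_1,\ldots,V_h$ having $e_G(V_i,V_j)=M$ if $\{i,j\}\in E(H)$ and $e_G(V_i,V_j)=0$ otherwise (so $M$ is an integer with $M\le n^2$). *)

(* Defs.v *)
From HB Require Import structures.
From mathcomp Require Import all_boot all_order all_algebra.
From mathcomp Require Import reals exp.

Set Implicit Arguments.
Unset Strict Implicit.
Unset Printing Implicit Defensive.

Import Order.TTheory GRing.Theory Num.Theory.
Local Open Scope ring_scope.

Record sgraph (T : finType) := SGraph {
  edges : {set {set T}};
  _ : [forall e in edges, #|e| == 2%N]
}.

HB.instance Definition _ (T : finType) := [isSub for @edges T].
HB.instance Definition _ (T : finType) := [Finite of sgraph T by <:].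

Section Graphs.
Variables (R : realType) (T : finType).
Implicit Types (G : sgraph T) (U W : {set T}).

Definition adj G (x y : T) : bool := [set x; y] \in edges G.

Definition nedges G : nat := #|edges G|.

(* [(S, F)] is a subgraph of [G]: the vertex set [S] and the edge set [F] are
   independent data, so subgraphs need not be induced or spanning. *)
Definition is_subgraph G (K : {set T} * {set {set T}}) : bool :=
  (K.2 \subset edges G) && [forall e in K.2, e \subset K.1].

(* The neutral value 0 is harmless when [2 <= nedges G]: a subgraph with at
   least two edges has at least three vertices, so all terms are positive. *)
Definition mdens G : R :=
  \big[Num.max/0]_(K : {set T} * {set {set T}}
                   | is_subgraph G K && (1 < #|K.2|)%N)
    ((#|K.2|%:R - 1) / (#|K.1|%:R - 2)).

Definition edges_between G U W : nat :=
  #|[set e in edges G | [exists x in U, exists y in W, e == [set x; y]]]|.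

Definition density G U W : R :=
  (edges_between G U W)%:R / (#|U|%:R * #|W|%:R).

(* The range [0 < eta, p <= 1] is not built in: for [eta > 1] the condition is
   vacuous on nonempty sets, rather than false. *)
Definition regular_pair G (eta p : R) U W : bool :=
  [forall U' : {set T}, forall W' : {set T},
    [&& U' \subset U, W' \subset W,
        eta * #|U|%:R <= #|U'|%:R & eta * #|W|%:R <= #|W'|%:R] ==>
    (`|density G U' W' - density G U W| <= eta * p)].

End Graphs.

Section Partite.
Variables (R : realType) (h n : nat).
Implicit Types (H : sgraph 'I_h) (V : 'I_h -> {set 'I_(h * n)})
  (G : sgraph 'I_(h * n)).

Definition equipartition V : Prop :=
  [/\ \bigcup_(i < h) V i = [set: 'I_(h * n)],
      forall i j, i != j -> [disjoint V i & V j]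
    & forall i, #|V i| = n].

Definition regular_graph H V (eta p : R) G : bool :=
  [forall i, forall j, adj H i j ==> regular_pair G eta p (V i) (V j)].

(* The parts being disjoint, a canonical copy, as a set of vertices, is the
   same thing as the family [v] listing its vertex in each part. *)
Definition canonical_copies H V G : {set {ffun 'I_h -> 'I_(h * n)}} :=
  [set v : {ffun 'I_h -> 'I_(h * n)} |
    [forall i, v i \in V i] &&
    [forall i, forall j, adj H i j ==> adj G (v i) (v j)]].

Definition ncopies H V G : nat := #|canonical_copies H V G|.

Definition partite V G : bool :=
  [forall e in edges G, forall i, (#|e :&: V i| <= 1)%N].

(* The sample space of G(n, M, H). *)
Definition partite_graphs H V (M : nat) : {set sgraph 'I_(h * n)} :=
  [set G | partite V G &&
    [forall i, forall j, (i != j) ==>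
      (edges_between G (V i) (V j) == if adj H i j then M else 0%N)]].

End Partite.

(* Probability of the event [A] for an element of [Omega] chosen uniformly at
   random; only meaningful when [Omega] is nonempty. *)
Definition uniform_pr (R : realType) (X : finType) (Omega : {set X})
    (A : pred X) : R :=
  #|[set x in Omega | A x]|%:R / #|Omega|%:R.

(* Main.v *)
From HB Require Import structures.
Require Import Defs.
From mathcomp Require Import all_boot all_order all_algebra all_fingroup.
From mathcomp Require Import boolp reals sequences exp.
From mathcomp Require Import ring lra zify.

(** The proof is by hypergraph containers. Consider the hypergraph whose
vertices are the pairs in the sets [V i] x [V j] with [ij] an edge of [H], and
whose hyperedges are the canonical copies of [H] in the complete partite graph:
there are [n ^ h] of them, they are [e(H)]-uniform, and a copy [v] meets the
colour class of the edge [e] of [H] in the single pair [v @: e]. A graph [G]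
with few copies of [H] is an almost independent set of this hypergraph.

Containers ([containers]). A graph [G] with few copies contains a bounded number
[L] of fingerprints, sets of [t = tau n^2] edges with [tau] a small multiple of
[p = M / n^2], that determine a set [C] which spans fewer than [eps n^h] copies
and contains all edges of [G] outside the fingerprints. One round of the
algorithm treats the edges of [H] one after another: from the current family of
copies it selects edges of [G] of large degree, keeps the copies through the
selected edges, and stops using copies through a partial copy whose degree has
become too large. If each edge of [H] yields [t] selections, then [G] contains
about [tau ^ e(H) n^h] copies, which is too many. Otherwise some edge of [H]
runs out of pairs of large degree in [G]; a constant proportion of the [n^2]
pairs of that colour has large degree, and all of them can be removed from the
container. The degrees required at the start are controlled by
[codegree_bound], and this is where [m(H)] enters:
[n ^ (h - v) <= tau ^ (e - 1) n ^ (h - 2)] for a subgraph with [v] vertices and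
[e] edges follows from [tau >= n ^ (- 1 / m(H))].

A set with few copies is thin where regular graphs are not ([sparse_level_set]). If
[C] has few copies, the counting argument for dense graphs, read backwards,
gives in each large box [W_1 x ... x W_h] large subsets of two of the sides
between which [C] has density below [rho]. Splitting boxes repeatedly, half of
the whole box is covered by boxes that are sparse at some edge of [H], so one
edge [e] of [H] is responsible for a proportion [1 / (2 e(H))]. Projecting to the
colour [e], one finds a set [Z] of pairs with [|C :&: Z| <= 8 e(H) rho n^2] while
every regular [G] has at least [M / (8 e(H))] edges in [Z]. The proportion of [M]
does not depend on [rho]; this is what makes a bound [alpha ^ M] with arbitrary
[alpha] possible, and it is why a single sparse pair of sets would not do.

Union bound ([fingerprint_union_bound]). A graph [G] in the bad event thus
contains its fingerprints, at most [L t] edges in all, and a further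
[b >= M / (16 e(H))] edges in the set [C :&: Z] determined by them. A given set
of [k] pairs lies in a random graph with probability at most [p ^ k]
([through_bound]), so that the fingerprints contribute a factor [O(1) ^ M]
and the remaining edges a factor [O(rho) ^ b], which is smaller than any
[a ^ M] when [rho] is small.

The constants are chosen in the order [rho], [eps], [L], [tau / p], [c]. *)

Set Implicit Arguments.
Unset Strict Implicit.
Unset Printing Implicit Defensive.

Import Order.TTheory GRing.Theory Num.Theory.
Local Open Scope ring_scope.

Ltac positivity :=
  repeat first
    [ done | exact: ltr0n | exact: ler0n | by rewrite ltr0n
    | apply: mulr_gt0 | apply: mulr_ge0 | apply: exprn_gt0 | apply: exprn_ge0
    | exact: ltr01 | exact: ler01 | apply: divr_gt0 | apply: divr_ge0
    | apply: addr_gt0 | apply: addr_ge0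
    | apply: powR_gt0 | apply: expR_gt0 | rewrite invr_gt0 | rewrite invr_ge0
    | apply: ltW ].

Lemma leq_card_bigcup (T J : finType) (P : pred J) (F : J -> {set T}) :
  (#|\bigcup_(j | P j) F j| <= \sum_(j | P j) #|F j|)%N.
Proof.
elim/big_rec2: _ => [|j a B _ H]; rewrite ?cards0 // cardsU leq_subLR.
by rewrite (leq_trans _ (leq_addl _ _)) // leq_add2l.
Qed.

(** * Selecting vertices of one colour in a coloured hypergraph *)

Section Growth.
Variables (R : realFieldType) (S X I : finType) (g : I -> S -> X).
Implicit Types (A : {set S}) (J : {set I}) (T G : {set X}).

(** A hyperedge is an index [s : S] whose vertex of colour [i] is [g i s]; indices
rather than vertex sets allow several hyperedges with the same vertices, as
happens for copies of a graph with isolated vertices. The partial hyperedge of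
[s] on the colours [J] is represented by the pair [(J, s)], and [agree J s] is the
set of hyperedges containing it. *)
Definition agree J (s : S) : {set S} :=
  [set s' | [forall j in J, g j s' == g j s]].

Definition degree A J s : nat := #|A :&: agree J s|.

Lemma agreeP J s s' : reflect {in J, forall j, g j s' = g j s} (s' \in agree J s).
Proof. by rewrite inE; apply: (iffP forall_inP) => H j /H /eqP. Qed.

Lemma agree_sym J s s' : (s' \in agree J s) = (s \in agree J s').
Proof. by apply/agreeP/agreeP => H j /H. Qed.

Lemma agree_eq J s s' : s' \in agree J s -> agree J s' = agree J s.
Proof.
move=> /agreeP H; apply/setP => u; apply/agreeP/agreeP => Hu j jJ.
  by rewrite Hu // H.
by rewrite Hu // H.
Qed.

Lemma degreeS A A' J s : A \subset A' -> (degree A J s <= degree A' J s)%N.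
Proof. by move=> sA; apply: subset_leq_card; apply: setSI. Qed.

(** Double counting of the pairs [(s, s')] with [s] in [B], [s'] in [A] that agree
on [J]. *)
Lemma heavy_count A B J (D b : R) :
    (forall s, (degree B J s)%:R <= D) ->
  b * #|[set s in B | b <= (degree A J s)%:R]|%:R <= D * #|A|%:R.
Proof.
move=> degB; set Y := [set s in B | _].
apply: (@le_trans _ _ (\sum_(s in Y) (degree A J s)%:R)).
  rewrite mulr_natr -sumr_const; apply: ler_sum => s.
  by rewrite inE => /andP[].
apply: (@le_trans _ _ (\sum_(s in A) (degree B J s)%:R)); last first.
  by rewrite mulr_natr -sumr_const; apply: ler_sum.
rewrite -!natr_sum ler_nat /degree.
under eq_bigr => s _ do rewrite -sum1dep_card big_mkcondr /=.
under [leqRHS]eq_bigr => s _ do rewrite -sum1dep_card big_mkcondr /=.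
rewrite exchange_big /=; apply: leq_sum => s' _.
rewrite [leqLHS]big_mkcond [leqRHS]big_mkcond /=; apply: leq_sum => s _.
rewrite agree_sym inE; case: (s \in B) => //=.
by case: ifP.
Qed.

Section Stage.
Variables (q : nat -> R) (rest : {set I}) (i : I) (A0 : {set S}).

Definition saturated A s : bool :=
  [exists J : {set I},
    [&& J != set0, J \subset rest & q #|J| <= (degree A J s)%:R]].

Definition unsaturated A : {set S} := [set s in A0 | ~~ saturated A s].

(** Hyperedges of [A0] through a saturated partial hyperedge are no longer used;
this is what keeps the degrees of the grown family bounded. *)
Definition extend A (x : X) : {set S} := A :|: [set s in unsaturated A | g i s == x].

Definition grow (xs : seq X) : {set S} := foldl extend set0 xs.

Definition unsatdeg A (x : X) : nat := #|[set s in unsaturated A | g i s == x]|.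

Lemma grow_rcons xs x : grow (rcons xs x) = extend (grow xs) x.
Proof. by rewrite /grow -cats1 foldl_cat. Qed.

Lemma unsaturatedS A A' : A \subset A' -> unsaturated A' \subset unsaturated A.
Proof.
move=> sA; apply/subsetP => s; rewrite !inE => /andP[-> /existsPn Hs] /=.
apply/existsPn => J; apply: contra (Hs J) => /and3P[-> -> H] /=.
by apply: le_trans H _; rewrite ler_nat degreeS.
Qed.

Lemma unsatdegS A A' x : A \subset A' -> (unsatdeg A' x <= unsatdeg A x)%N.
Proof.
move=> /unsaturatedS /subsetP sA; apply: subset_leq_card; apply/subsetP => s.
by rewrite inE => /andP[/sA ? ?]; apply/setIdP.
Qed.

Lemma grow_sub xs s : s \in grow xs -> s \in A0 /\ g i s \in xs.
Proof.
elim/last_ind: xs => [|xs x IH]; first by rewrite inE.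
rewrite grow_rcons !inE mem_rcons inE => /orP[/IH[-> ->]|]; first by rewrite orbT.
by case/andP=> /andP[-> _] ->.
Qed.

(** One pass over the candidates is enough: the available degree of a vertex only
decreases as the family grows, so a vertex once refused remains of low degree.
Since the family depends only on the list [T] of selected vertices, everything
derived from it is a function of the fingerprint and not of the scanned set. *)
Lemma greedy_selection (t : nat) (d : R) (xs : seq X) : uniq xs ->
  exists T : seq X, [/\ subseq T xs, (size T <= t)%N,
    d * (size T)%:R <= #|grow T|%:R &
    size T = t \/
    forall x, x \in xs -> x \notin T -> (unsatdeg (grow T) x)%:R < d].
Proof.
elim/last_ind: xs => [_|xs x IH].
  by exists [::]; split=> //; [rewrite mulr0 | right].
rewrite rcons_uniq => /andP[xNxs /IH [T [sT szT cT]]].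
have sTx : subseq T (rcons xs x) by apply: subseq_trans sT (subseq_rcons _ _).
case=> [szTt|lowT]; first by exists T; split=> //; left.
have [szTt|szTt] := eqVneq (size T) t; first by exists T; split=> //; left.
have [lowx|highx] := ltP (unsatdeg (grow T) x)%:R d.
  exists T; split=> //; right=> y; rewrite mem_rcons inE => /orP[/eqP->//|].
  exact: lowT.
exists (rcons T x); split.
- by rewrite -!cats1 cat_subseq.
- by rewrite size_rcons ltn_neqAle szTt.
- rewrite grow_rcons size_rcons /extend cardsU disjoint_setI0 ?cards0 ?subn0.
    by rewrite natrD -natr1 mulrDr mulr1 lerD.
  rewrite -setI_eq0; apply/eqP/setP => s; rewrite !inE.
  apply/negP => /andP[/grow_sub[_ gT]] /andP[_ /eqP gx].
  by move: xNxs; rewrite -gx (mem_subseq sT).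
- right=> y; rewrite !mem_rcons !inE => /orP[/eqP->|yxs]; first by rewrite eqxx.
  rewrite negb_or => /andP[_ yNT].
  apply: le_lt_trans (lowT _ yxs yNT).
  by rewrite ler_nat grow_rcons unsatdegS // subsetUl.
Qed.

(** A partial hyperedge below its threshold can overshoot it only by the
contribution of one more vertex [x], which is the degree in [A0] of the partial
hyperedge extended by [x]. *)
Lemma grow_degree (D : nat -> R) xs J s :
    (forall J s, J != set0 -> J \subset i |: rest ->
       (degree A0 J s)%:R <= D #|J|) ->
    (forall l, 0 <= q l) -> (forall l, 0 <= D l) ->
    i \notin rest -> J != set0 -> J \subset rest ->
  (degree (grow xs) J s)%:R <= q #|J| + D #|J|.+1.
Proof.
move=> degA0 q0 D0 iNrest J0 Jrest.
elim/last_ind: xs => [|xs x IH].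
  by rewrite /grow /degree set0I cards0 addr_ge0.
rewrite grow_rcons; set A := grow xs in IH *.
have [sat|/ltW unsat] := leP (q #|J|) (degree A J s)%:R.
  suff -> : degree (extend A x) J s = degree A J s by [].
  congr #|pred_of_set _|; apply/setP => u; rewrite !inE.
  case: (u \in A) => //=; apply/negP => /andP[/andP[/andP[_ /existsPn nsat] _]].
  rewrite -/(mem (agree J s) u) => us.
  have /negP := nsat J; apply; rewrite J0 Jrest /=.
  have /agree_eq : u \in agree J s by rewrite inE.
  by rewrite /degree => ->.
pose Y := [set u in unsaturated A | g i u == x] :&: agree J s.
apply: (@le_trans _ _ ((degree A J s)%:R + #|Y|%:R)).
  rewrite -natrD ler_nat /degree /extend setIUl.
  by rewrite cardsU leq_subr.
apply: lerD => //.
have [->|[u uY]] := set_0Vmem Y; first by rewrite cards0.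
have iNJ : i \notin J by apply: contra iNrest => /(subsetP Jrest).
have -> : #|J|.+1 = #|i |: J| by rewrite cardsU1 iNJ.
apply: le_trans (degA0 (i |: J) u _ _); first last.
- exact: setUS.
- by apply/set0Pn; exists i; rewrite setU11.
rewrite ler_nat; apply: subset_leq_card; apply/subsetP => z.
move: uY; rewrite !inE => /andP[/andP[_ /eqP ux] /forall_inP us].
move=> /andP[/andP[/andP[-> _] /eqP zx] /forall_inP zs] /=.
apply/forall_inP => j; rewrite !inE => /orP[/eqP->|jJ]; first by rewrite zx ux.
by rewrite (eqP (us _ jJ)) (eqP (zs _ jJ)).
Qed.

Lemma grow_card (D1 : R) xs :
    (forall s, (degree A0 [set i] s)%:R <= D1) -> 0 <= D1 ->
  #|grow xs|%:R <= D1 * (size xs)%:R.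
Proof.
move=> degA0 D0; elim/last_ind: xs => [|xs x IH].
  by rewrite /grow cards0 mulr0.
rewrite grow_rcons size_rcons -natr1 mulrDr mulr1.
pose Y := [set u in unsaturated (grow xs) | g i u == x].
apply: (@le_trans _ _ (#|grow xs|%:R + #|Y|%:R)).
  by rewrite -natrD ler_nat cardsU leq_subr.
apply: lerD => //.
have [->|[u uY]] := set_0Vmem Y; first by rewrite cards0.
apply: le_trans (degA0 u); rewrite ler_nat; apply: subset_leq_card.
apply/subsetP => z; move: uY; rewrite !inE => /andP[_ /eqP ux].
move=> /andP[/andP[-> _] /eqP zx] /=.
by apply/forall_inP => j; rewrite inE => /eqP ->; rewrite zx ux.
Qed.

End Stage.
End Growth.

(** * One stage: many hyperedges, or many vertices of high degree *)

Section OneStage.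
Variables (R : realFieldType) (I S X : finType) (g : I -> S -> X).
Variables (rest : {set I}) (i : I) (A0 : {set S}).
Variables (K beta tau w N : R) (t : nat).
Hypotheses (K_gt0 : 0 < K) (beta_gt0 : 0 < beta) (tau_gt0 : 0 < tau).
Hypotheses (w_gt0 : 0 < w) (N_gt0 : 0 < N) (tE : t%:R = tau * N).
Hypothesis iNrest : i \notin rest.
Hypothesis degA0 : forall J s, J != set0 -> J \subset i |: rest ->
  (degree g A0 J s)%:R <= K * tau ^+ #|J|.-1 * w.
Hypothesis cardA0 : beta * N * w <= #|A0|%:R.
Hypothesis cardN : #|g i @: A0|%:R <= N.

(** The degrees allowed in the grown family are those of [A0] scaled by [tau],
times a constant. This constant is so large that the saturated partial
hyperedges, of at most [#|{set I}|] types, together destroy at most a quarter of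
[A0]. *)
Definition satur_factor : R := 4 * #|{set I}|%:R * K / beta.
Definition satur_level (l : nat) : R := satur_factor * K * tau ^+ l * w.
Definition grown (T : {set X}) : {set S} :=
  grow g satur_level rest i A0 (enum T).
Definition high (T : {set X}) : {set X} :=
  [set x | beta / 2 * w <= (unsatdeg g satur_level rest i A0 (grown T) x)%:R].

Let nsets_gt0 : 0 < #|{set I}|%:R :> R.
Proof. by rewrite ltr0n; apply/card_gt0P; exists set0. Qed.

Let factor_gt0 : 0 < satur_factor.
Proof. by rewrite /satur_factor divr_gt0 ?mulr_gt0. Qed.

Lemma grown_degree (T : {set X}) J s : J != set0 -> J \subset rest ->
  (degree g (grown T) J s)%:R
    <= (satur_factor + 1) * K * tau ^+ #|J|.-1 * (tau * w).
Proof.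
move=> J0 Jrest.
have := @grow_degree R S X I g satur_level rest i A0
  (fun l => K * tau ^+ l.-1 * w) (enum T) J s degA0 _ _ iNrest J0 Jrest.
have -> : satur_level #|J| + K * tau ^+ #|J| * w
    = (satur_factor + 1) * K * tau ^+ #|J|.-1 * (tau * w).
  rewrite -card_gt0 in J0; rewrite /satur_level -{1 2}(prednK J0) exprS; ring.
by apply=> l; rewrite /satur_level; positivity.
Qed.

(** At least three quarters of the minimal size of [A0] remains available. The
vertices of low degree account for half of it at most, and no vertex has degree
larger than [K * w], so many vertices of high degree are needed. *)
Lemma high_card (T : {set X}) : (#|T| <= t)%N -> beta / (4 * K) * N <= #|high T|%:R.
Proof.
move=> Tt; set A := grown T.
have degi s : (degree g A0 [set i] s)%:R <= K * w.
  have := @degA0 [set i] s; rewrite cards1 expr0 mulr1; apply.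
    by apply/set0Pn; exists i; rewrite inE.
  by rewrite sub1set setU11.
have Kw0 : 0 <= K * w by positivity.
have cardA : #|A|%:R <= K * w * (tau * N).
  apply: le_trans (grow_card satur_level rest (enum T) degi Kw0) _.
  by rewrite -tE ler_wpM2l // -cardE ler_nat.
pose heavy (J : {set I}) := [set s in A0 | satur_level #|J| <= (degree g A J s)%:R].
have heavyP (J : {set I}) : J != set0 -> J \subset rest ->
    #|heavy J|%:R <= beta * N * w / (4 * #|{set I}|%:R).
  move=> J0 Jrest.
  have := @heavy_count R S X I g A A0 J (K * tau ^+ #|J|.-1 * w)
    (satur_level #|J|) (fun s => degA0 s J0 (subset_trans Jrest (subsetUr _ _))).
  rewrite -/(heavy J).
  have -> : satur_level #|J| = satur_factor * tau * (K * tau ^+ #|J|.-1 * w).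
    rewrite -card_gt0 in J0; rewrite /satur_level -{1}(prednK J0) exprS; ring.
  rewrite -mulrA mulrCA ler_pM2l; last by positivity.
  move=> /le_trans /(_ cardA) H.
  rewrite -(ler_pM2l factor_gt0) -(ler_pM2l tau_gt0).
  have -> : tau * (satur_factor * (beta * N * w / (4 * #|{set I}|%:R)))
     = K * w * (tau * N).
    rewrite /satur_factor; field.
    by rewrite (gt_eqF beta_gt0) (gt_eqF nsets_gt0).
  by rewrite mulrCA mulrA.
(* Each saturated partial hyperedge has many extensions in the grown family,
   which is small, so there are few hyperedges of [A0] through one of them. *)
have cardfree : 3 / 4 * beta * N * w
    <= #|unsaturated g satur_level rest A0 A|%:R.
  have sub : A0 \subset unsaturated g satur_level rest A0 A :|:
      \bigcup_(J | (J != set0) && (J \subset rest)) heavy J.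
    apply/subsetP => s sA; rewrite !inE sA /=.
    case: (boolP (saturated _ _ _ _ _)) => //= /existsP[J /and3P[J0 Jr HJ]].
    by apply/bigcupP; exists J; rewrite ?J0 // inE sA.
  have cardU : #|\bigcup_(J | (J != set0) && (J \subset rest)) heavy J|%:R
      <= beta * N * w / 4.
    apply: (@le_trans _ _ (\sum_(J | (J != set0) && (J \subset rest)) #|heavy J|%:R)).
      by rewrite -natr_sum ler_nat leq_card_bigcup.
    apply: (@le_trans _ _ (\sum_(J : {set I}) beta * N * w / (4 * #|{set I}|%:R))).
      rewrite big_mkcond /=; apply: ler_sum => J _.
      case: ifP => [/andP[]|_]; first exact: heavyP.
      by positivity.
    rewrite sumr_const -mulr_natr le_eqVlt; apply/orP; left; apply/eqP.
    by field; rewrite (gt_eqF nsets_gt0).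
  have := subset_leq_card sub; rewrite cardsU => /leq_trans/(_ (leq_subr _ _)).
  by rewrite -(ler_nat R) natrD; move: cardA0 cardU; lra.
have cardsum : #|unsaturated g satur_level rest A0 A|%:R
    <= #|high T|%:R * (K * w) + N * (beta / 2 * w).
  set F := unsaturated _ _ _ _ _.
  have -> : #|F| = (\sum_(x in g i @: F) #|[set s in F | g i s == x]|)%N.
    rewrite -sum1_card (partition_big_imset (g i)) /=.
    by apply: eq_bigr => x _; rewrite -sum1dep_card.
  rewrite (bigID (mem (high T))) /= natrD; apply: lerD.
    rewrite natr_sum.
    apply: (@le_trans _ _ (\sum_(x in high T) K * w)); last first.
      by rewrite sumr_const mulr_natl.
    rewrite big_mkcond [leRHS]big_mkcond /=; apply: ler_sum => x _.
    case: ifP => [/andP[/imsetP[s sF ->] ->]|_]; last by case: ifP.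
    apply: le_trans (degi s); rewrite ler_nat; apply: subset_leq_card.
    apply/subsetP => u; rewrite !inE => /andP[/andP[-> _] /eqP us] /=.
    by apply/forall_inP => j; rewrite inE => /eqP->; apply/eqP.
  rewrite natr_sum.
  apply: (@le_trans _ _ (\sum_(x in g i @: A0) beta / 2 * w)); last first.
    rewrite sumr_const -[leLHS]mulr_natl ler_wpM2r //.
    by positivity.
  rewrite big_mkcond [leRHS]big_mkcond /=; apply: ler_sum => x _.
  have ge0 : 0 <= beta / 2 * w by positivity.
  case: ifP => [/andP[/imsetP[s sF ->] lowx]|_]; last by case: ifP.
  rewrite imset_f; last by move: sF; rewrite inE => /andP[].
  by move: lowx; rewrite inE -ltNge => /ltW.
rewrite mulrAC ler_pdivrMr ?mulr_gt0 // -(ler_pM2r w_gt0).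
by move: (le_trans cardfree cardsum); lra.
Qed.

Lemma high_sub (T : {set X}) x : x \in high T -> x \in g i @: A0.
Proof.
rewrite inE => H.
have : (0 < unsatdeg g satur_level rest i A0 (grown T) x)%N.
  by rewrite -(ltr_nat R); apply: lt_le_trans H; rewrite mulr_gt0 ?divr_gt0.
case/card_gt0P => s; rewrite !inE => /andP[/andP[sA _] /eqP <-].
exact: imset_f.
Qed.

Lemma grown_sub (T : {set X}) s : s \in grown T -> s \in A0 /\ g i s \in T.
Proof. by case/grow_sub => ->; rewrite mem_enum. Qed.

(** When fewer than [t] vertices are selected, all vertices of [G] outside [T] are of
low degree. *)
Lemma stage_select (G : {set X}) : exists T : {set X},
  [/\ T \subset G, (#|T| <= t)%N &
      beta / 2 * N * (tau * w) <= #|grown T|%:R \/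
      forall x, x \in high T -> x \in G -> x \in T].
Proof.
have [T [sT szT cT alt]] := greedy_selection g satur_level rest i A0 t (beta / 2 * w)
   (enum_uniq G).
(* [grown] scans a set in the order of its type, which is the order in which the
   sequence [T] was selected. *)
have enumT : enum [set x in T] = T.
  have uE : uniq (Finite.enum X) by rewrite -enumT enum_uniq.
  rewrite /enum_mem.
  have := sT; rewrite /enum_mem => /subseq_trans /(_ (filter_subseq _ _)).
  move/(subseq_uniqP uE) => {2}->.
  by apply: eq_filter => x; rewrite !inE.
exists [set x in T]; split.
- by apply/subsetP => x; rewrite inE => /(mem_subseq sT); rewrite mem_enum.
- by rewrite cardE enumT.
rewrite /high /grown enumT; case: alt => [szt|low].
  left; apply: le_trans cT; rewrite szt tE.
  by rewrite le_eqVlt; apply/orP; left; apply/eqP; ring.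
right=> x; rewrite !inE => Hx xG; apply: contraLR Hx => /low.
by rewrite mem_enum -ltNge; apply.
Qed.
End OneStage.

(** * Containers *)

Definition copies_in (S X I : finType) (g : I -> S -> X) (S0 : {set S})
    (cs : seq I) (C : {set X}) : {set S} :=
  [set s in S0 | all (fun i => g i s \in C) cs].

Definition bounded_parts (X : finType) (G : {set X}) (t : nat)
    (Ts : seq {set X}) : Prop :=
  forall T, T \in Ts -> T \subset G /\ (#|T| <= t)%N.

(** The stages are chained over the list of colours: the family grown at one stage
is the input of the next, with [w] replaced by [tau * w], [beta] by [beta / 2] and
[K] by a larger constant. As [F] is a function of the fingerprints alone, it must
decide without seeing [G] whether a stage succeeded: it tests whether the grown
family is large. If it is not, the stage must have run out of vertices of high
degree, and these are the elements to be removed. *)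
Lemma removable_elements (R : realFieldType) (I : finType) (r : nat) :
  forall K beta : R, 0 < K -> 0 < beta ->
  exists2 xi : R, 0 < xi & exists2 beta0 : R, 0 < beta0 &
  forall (S X : finType) (g : I -> S -> X) (cs : seq I),
    size cs = r -> uniq cs ->
  forall (tau w N : R) (t : nat), 0 < tau -> 0 < w -> 0 < N -> t%:R = tau * N ->
  forall A : {set S},
    (forall (J : {set I}) s, J != set0 -> J \subset [set i in cs] ->
       (degree g A J s)%:R <= K * tau ^+ #|J|.-1 * w) ->
    beta * N * w <= #|A|%:R ->
    (forall i, i \in cs -> #|g i @: A|%:R <= N) ->
  exists F : seq {set X} -> {set X}, forall G : {set X},
  exists Ts, [/\ size Ts = r, bounded_parts G t Ts &
    beta0 * N * (tau ^+ r * w) <= #|copies_in g A cs G|%:R \/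
    [/\ xi * N <= #|F Ts|%:R,
        forall x, x \in F Ts -> exists2 i, i \in cs & x \in g i @: A &
        forall x, x \in F Ts -> x \in G -> exists2 T, T \in Ts & x \in T]].
Proof.
elim: r => [|r IH] K beta K0 beta0.
  exists 1 => //; exists beta => // S X g cs /size0nil -> _ tau w N t _ _ _ _ A _.
  move=> cA _; exists (fun=> set0) => G; exists [::]; split=> //; left.
  rewrite expr0 mul1r; apply: le_trans cA _; rewrite ler_nat.
  by apply: subset_leq_card; apply/subsetP => s; rewrite inE => ->.
have nsets_gt0 : 0 < #|{set I}|%:R :> R.
  by rewrite ltr0n; apply/card_gt0P; exists set0.
set K1 : R := (4 * #|{set I}|%:R * K / beta + 1) * K.
have K1_gt0 : 0 < K1 by rewrite /K1; positivity.
have beta2_gt0 : 0 < beta / 2 by positivity.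
have [xi1 xi1_gt0 [b1 b1_gt0 {}IH]] := IH _ _ K1_gt0 beta2_gt0.
exists (Num.min xi1 (beta / (4 * K))).
  by rewrite lt_min xi1_gt0 /=; positivity.
exists b1 => // S X g [//|i rest] [szr] /= /andP[iNrest urest].
move=> tau w N t tau0 w0 N0 tE A degA cA cardN.
have iN : i \notin [set j in rest] by rewrite inE.
have degA' (J : {set I}) s : J != set0 -> J \subset i |: [set j in rest] ->
    (degree g A J s)%:R <= K * tau ^+ #|J|.-1 * w.
  move=> J0 sJ; apply: degA => //; apply: subset_trans sJ _.
  by apply/subsetP => j; rewrite !inE.
have cNi : #|g i @: A|%:R <= N by apply: cardN; rewrite inE eqxx.
pose A' := grown g [set j in rest] i A K beta tau w.
pose good T := beta / 2 * N * (tau * w) <= #|A' T|%:R.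
have A'sub T s : s \in A' T -> s \in A /\ g i s \in T by apply: grown_sub.
have next (T : {set X}) : exists F : seq {set X} -> {set X}, good T ->
    forall G : {set X}, exists Ts, [/\ size Ts = r, bounded_parts G t Ts &
    b1 * N * (tau ^+ r * (tau * w)) <= #|copies_in g (A' T) rest G|%:R \/
    [/\ xi1 * N <= #|F Ts|%:R,
        forall x, x \in F Ts -> exists2 i, i \in rest & x \in g i @: A' T &
        forall x, x \in F Ts -> x \in G -> exists2 T, T \in Ts & x \in T]].
  have [gT|ngT] := boolP (good T); last by exists (fun=> set0).
  have [] := IH S X g rest szr urest tau (tau * w) N t tau0 _ N0 tE (A' T).
  - by positivity.
  - move=> J s J0 sJ.
    exact: (grown_degree K0 beta0 tau0 w0 iN degA').
  - exact: gT.
  - move=> j jr; apply: le_trans (cardN j _); last by rewrite inE jr orbT.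
    rewrite ler_nat; apply: subset_leq_card; apply: imsetS.
    by apply/subsetP => s /A'sub[].
  by move=> F HF; exists F.
have [Fs HFs] := choice next.
exists (fun Ts => if Ts is T :: Ts' then
   if good T then Fs T Ts' else high g [set j in rest] i A K beta tau w T
   else set0) => G.
have [T [sT cT alt]] := stage_select g [set j in rest] i A K beta w tE G.
have addT Ts : bounded_parts G t Ts -> bounded_parts G t (T :: Ts).
  by move=> H U; rewrite inE => /orP[/eqP->|/H].
have [gT|ngT] := boolP (good T); last first.
  case: alt => [gT|highG]; first by rewrite /good gT in ngT.
  exists (T :: nseq r set0); rewrite (negbTE ngT); split.
  - by rewrite /= size_nseq.
  - by apply: addT => U; rewrite mem_nseq => /andP[_ /eqP->]; rewrite sub0set cards0.
  right; split.
  - apply: le_trans (high_card K0 beta0 tau0 w0 N0 tE degA' cA cNi cT).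
    by apply: ler_wpM2r; [exact: ltW|rewrite ge_min lexx orbT].
  - by move=> x /(high_sub beta0 w0) ?; exists i; rewrite ?inE ?eqxx.
  - by move=> x xh xG; exists T; rewrite ?inE ?eqxx // highG.
have [Ts [szTs bTs alt']] := HFs T gT G.
exists (T :: Ts); rewrite gT; split; [by rewrite /= szTs|exact: addT|].
case: alt' => [many|[H1 H2 H3]]; [left|right].
  rewrite exprSr -(mulrA (tau ^+ r)); apply: le_trans many _; rewrite ler_nat.
  apply: subset_leq_card; apply/subsetP => s.
  rewrite !inE => /andP[/A'sub[-> gT'] /= ->].
  by rewrite (subsetP sT).
split.
- apply: le_trans H1; apply: ler_wpM2r; first exact: ltW.
  by rewrite ge_min lexx.
- move=> x /H2[j jr /imsetP[s /A'sub[sA _] ->]]; exists j.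
    by rewrite inE jr orbT.
  exact: imset_f.
- by move=> x /H3 H /H[U UT xU]; exists U => //; rewrite inE UT orbT.
Qed.

(** Each round removes [xi * N] elements from a container that started with at most
[r * N], so that boundedly many rounds leave fewer than [eps * N * w]
hyperedges. *)
Lemma containers (R : realType) (I : finType) (r : nat) (eps : R) :
    (0 < r)%N -> 0 < eps ->
  exists L : nat, exists2 beta : R, 0 < beta &
  forall (S X : finType) (g : I -> S -> X) (cs : seq I),
    size cs = r -> uniq cs ->
  forall (tau w N : R) (t : nat), 0 < tau -> 0 < w -> 0 < N -> t%:R = tau * N ->
  forall S0 : {set S},
    (forall (J : {set I}) s, J != set0 -> J \subset [set i in cs] ->
       (degree g S0 J s)%:R <= tau ^+ #|J|.-1 * w) ->
    (forall i, i \in cs -> #|g i @: S0|%:R <= N) ->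
  exists F : seq {set X} -> {set X}, forall G : {set X},
    #|copies_in g S0 cs G|%:R < beta * N * (tau ^+ r * w) ->
  exists Ts, [/\ size Ts = L, bounded_parts G t Ts,
    #|copies_in g S0 cs (F Ts)|%:R < eps * N * w &
    forall i x, i \in cs -> x \in g i @: S0 -> x \in G ->
      (forall T, T \in Ts -> x \notin T) -> x \in F Ts].
Proof.
move=> r0 eps0.
have [xi xi0 [beta beta0 step]] := @removable_elements R I r 1 eps ltr01 eps0.
pose m := Num.bound (r%:R / xi).
exists (m * r)%N, beta => // S X g cs szcs ucs tau w N t tau0 w0 N0 tE S0 degS0 cardN.
(* [C] is the current container, and [k] bounds the number of rounds that are
   still possible. *)
have iter k : forall C : {set X}, #|C|%:R <= k%:R * (xi * N) ->
  exists F : seq {set X} -> {set X}, forall G : {set X},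
    #|copies_in g S0 cs G|%:R < beta * N * (tau ^+ r * w) ->
  exists Ts, [/\ size Ts = (k * r)%N, bounded_parts G t Ts,
    #|copies_in g S0 cs (F Ts)|%:R < eps * N * w &
    forall x, x \in C -> x \in G ->
      (forall T, T \in Ts -> x \notin T) -> x \in F Ts].
  elim: k => [|k IH] C cC; set A := copies_in g S0 cs C.
    exists (fun=> C) => G _; exists [::]; split=> //.
    move: cC; rewrite mul0r lern0 cards_eq0 => /eqP ->.
    suff -> : copies_in g S0 cs set0 = set0 by rewrite cards0; positivity.
    apply/setP => s; rewrite !inE; case: cs szcs r0 {ucs degS0 cardN A} => [<-//|i cs' _ _].
    by rewrite /= inE andbF.
  have [few|many] := ltP #|A|%:R (eps * N * w).
    exists (fun=> C) => G _; exists (nseq (k.+1 * r) set0); split=> //.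
      by rewrite size_nseq.
    by move=> U; rewrite mem_nseq => /andP[_ /eqP->]; rewrite sub0set cards0.
  have AS0 s : s \in A -> s \in S0 by rewrite inE => /andP[].
  have [] := step S X g cs szcs ucs tau w N t tau0 w0 N0 tE A.
  - move=> J s J0 sJ; rewrite mul1r; apply: le_trans (degS0 J s J0 sJ).
    by rewrite ler_nat degreeS //; apply/subsetP.
  - exact: many.
  - move=> i ics; apply: le_trans (cardN i ics); rewrite ler_nat.
    by apply/subset_leq_card/imsetS/subsetP.
  move=> F1 HF1.
  have next (Y : {set X}) : exists F : seq {set X} -> {set X},
      #|C :\: Y|%:R <= k%:R * (xi * N) -> forall G : {set X},
      #|copies_in g S0 cs G|%:R < beta * N * (tau ^+ r * w) ->
      exists Ts, [/\ size Ts = (k * r)%N, bounded_parts G t Ts,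
      #|copies_in g S0 cs (F Ts)|%:R < eps * N * w &
      forall x, x \in C :\: Y -> x \in G ->
      (forall T, T \in Ts -> x \notin T) -> x \in F Ts].
    have [/IH[F HF]|nle] := boolP (#|C :\: Y|%:R <= k%:R * (xi * N)).
      by exists F.
    by exists (fun=> set0).
  have [Fs HFs] := choice next.
  exists (fun Ts => Fs (F1 (take r Ts)) (drop r Ts)) => G few.
  have [Ts1 [sz1 b1 alt]] := HF1 G.
  have {alt} [Y1 Y2 Y3] : [/\ xi * N <= #|F1 Ts1|%:R,
        forall x, x \in F1 Ts1 -> x \in C &
        forall x, x \in F1 Ts1 -> x \in G -> exists2 T, T \in Ts1 & x \in T].
    case: alt => [lots|[Y1 Y2 Y3]].
      suff le : (#|copies_in g A cs G| <= #|copies_in g S0 cs G|)%N.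
        have := le_lt_trans (le_trans lots _) few.
        by rewrite ler_nat le ltxx => /(_ isT).
      apply/subset_leq_card/subsetP => s; rewrite inE => /andP[/AS0 sS sG].
      by rewrite inE sS.
    split=> // x /Y2[i ics /imsetP[s]]; rewrite inE => /andP[_ /allP sC] ->.
    exact: sC.
  have smaller : #|C :\: F1 Ts1|%:R <= k%:R * (xi * N).
    have YC : F1 Ts1 \subset C by apply/subsetP.
    rewrite cardsD (setIidPr YC) natrB ?subset_leq_card // lerBlDr.
    by apply: le_trans cC _; rewrite -natr1 mulrDl mul1r lerD2l.
  have [Ts2 [sz2 b2 fewF memF]] := HFs _ smaller G few.
  exists (Ts1 ++ Ts2).
  rewrite take_size_cat // drop_size_cat //; split=> //.
  - by rewrite size_cat sz1 sz2.
  - by move=> U; rewrite mem_cat => /orP[/b1|/b2].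
  - move=> x xC xG notT; apply: memF => //; last first.
      by move=> T TT; apply: notT; rewrite mem_cat TT orbT.
    rewrite inE xC andbT; apply/negP => /Y3 /(_ xG)[T TT xT].
    by have := notT T; rewrite mem_cat TT xT => /(_ isT).
pose E : {set X} := \bigcup_(i in [set i in cs]) g i @: S0.
have cE : #|E|%:R <= m%:R * (xi * N).
  apply: (@le_trans _ _ (r%:R * N)).
    apply: (@le_trans _ _ (\sum_(i in [set i in cs]) #|g i @: S0|%:R)).
      by rewrite -natr_sum ler_nat leq_card_bigcup.
    apply: (@le_trans _ _ (\sum_(i in [set i in cs]) N)).
      by apply: ler_sum => i; rewrite inE => /cardN.
    by rewrite sumr_const cardsE (card_uniqP ucs) szcs -[leLHS]mulr_natl.
  rewrite mulrA ler_pM2r // -ler_pdivrMr //; apply/ltW/archi_boundP; positivity.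
have [F HF] := iter m E cE.
exists F => G /HF[Ts [sz b few memF]]; exists Ts; split=> // i x ics xi1 xG notT.
by apply: memF => //; apply/bigcupP; exists i; rewrite ?inE.
Qed.

(** * Boxes and the embedding lemma *)

Section Boxes.
Variables (T : finType) (h : nat).
Implicit Types (b : 'I_h -> {set T}) (C G : {set {set T}}) (U W : {set T}).

Definition box b : {set {ffun 'I_h -> T}} :=
  [set v : {ffun 'I_h -> T} | [forall l, v l \in b l]].

Lemma boxP b (v : {ffun 'I_h -> T}) : reflect (forall l, v l \in b l) (v \in box b).
Proof. by rewrite inE; apply: forallP. Qed.

Lemma card_box b : #|box b| = (\prod_l #|b l|)%N.
Proof.
rewrite cardsE (@card_family _ _ (fun l => mem (b l))).
by rewrite foldrE big_map big_enum.
Qed.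

Definition upd b i U : 'I_h -> {set T} := fun l => if l == i then U else b l.

Lemma upd_same b i U : upd b i U i = U.
Proof. by rewrite /upd eqxx. Qed.

Lemma upd_other b i U l : l != i -> upd b i U l = b l.
Proof. by rewrite /upd => /negbTE ->. Qed.

Definition pair_count C U W : nat :=
  (\sum_(x in U) \sum_(y in W) ([set x; y] \in C))%N.

(** The proportion of tuples in a box whose [i]-th and [j]-th entries form a pair of
[C] is the density of [C] between the sides [b i] and [b j]. *)
Lemma box_pair_count C b i j : i != j ->
  (#|[set v : {ffun 'I_h -> T} in box b | [set v i; v j] \in C]| * (#|b i| * #|b j|)
   = pair_count C (b i) (b j) * #|box b|)%N.
Proof.
move=> ij; pose rest := (\prod_(l | (l != i) && (l != j)) #|b l|)%N.
have -> : #|box b| = (#|b i| * #|b j| * rest)%N.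
  by rewrite card_box (bigD1 i) //= (bigD1 j) 1?eq_sym //= mulnA.
rewrite [LHS]mulnC [RHS]mulnCA; congr (_ * _)%N.
have fib x y : x \in b i -> y \in b j ->
   #|[set v : {ffun 'I_h -> T} in box b | (v i == x) && (v j == y)]| = rest.
  move=> xb yb; pose b' := upd (upd b i [set x]) j [set y].
  have -> : [set v : {ffun 'I_h -> T} in box b | (v i == x) && (v j == y)] = box b'.
    apply/setP => v; rewrite !inE; apply/idP/forallP.
      case/and3P => /forallP vb vi vj l; rewrite /b' /upd.
      by case: eqVneq => [->|_]; [rewrite inE|case: eqVneq => [->|_]; rewrite ?inE].
    move=> vb'; have := vb' i; have := vb' j.
    rewrite /b' upd_same upd_other // upd_same !inE => -> ->; rewrite !andbT.
    apply/forallP => l; have := vb' l; rewrite /b' /upd.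
    case: eqVneq => [->|_]; first by rewrite inE => /eqP->.
    by case: eqVneq => [->|_ //]; rewrite inE => /eqP->.
  rewrite card_box (bigD1 i) //= (bigD1 j) 1?eq_sym //=.
  rewrite {1 2}/b' upd_same upd_other // upd_same !cards1 !mul1n.
  by apply: eq_bigr => l /andP[li lj]; rewrite /b' !upd_other.
rewrite -sum1dep_card big_mkcondr /=.
rewrite (partition_big (fun v : {ffun 'I_h -> T} => v i) (mem (b i))) /=; last first.
  by move=> v /boxP.
rewrite /pair_count big_distrl /=; apply: eq_bigr => x xb.
rewrite (partition_big (fun v : {ffun 'I_h -> T} => v j) (mem (b j))) /=; last first.
  by move=> v /andP[/boxP].
rewrite big_distrl /=; apply: eq_bigr => y yb.
rewrite -(fib x y xb yb) -sum1dep_card big_distrr /=.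
apply: eq_big => v; first by rewrite andbA.
by move=> /andP[/andP[_ /eqP->] /eqP->]; case: ifP.
Qed.

Lemma imset_pair (v : {ffun 'I_h -> T}) i j : v @: [set i; j] = [set v i; v j].
Proof. by rewrite imsetU1 imset_set1. Qed.

End Boxes.

Section Embedding.
Variables (R : realFieldType) (T : finType) (h : nat).
Variables (E : {set {set 'I_h}}) (C : {set {set T}}) (b0 : 'I_h -> {set T}).
Variables (m : 'I_h -> R) (rho eta : R).
Hypotheses (rho_gt0 : 0 < rho) (rho_le1 : rho <= 1) (eta_ge0 : 0 <= eta).
Hypothesis m_ge0 : forall l, 0 <= m l.
Hypothesis dense : forall i j (U W : {set T}), i != j -> [set i; j] \in E ->
  U \subset b0 i -> W \subset b0 j ->
  eta * m i <= #|U|%:R -> eta * m j <= #|W|%:R ->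
  rho * (#|U|%:R * #|W|%:R) <= (pair_count C U W)%:R.

Definition partial_copies (A : {set 'I_h}) (b : 'I_h -> {set T}) :=
  [set v : {ffun 'I_h -> T} in box b | [forall i in A, forall j in A,
     (i != j) && ([set i; j] \in E) ==> ([set v i; v j] \in C)]].

(** Embedding the vertices of [A] one at a time: a vertex [x] of [b a] is bad for [j]
if it has fewer than [rho * #|b j|] neighbours in [b j]; the vertices bad for [j]
form with [b j] a pair of density below [rho], so there are few of them. A vertex
that is not bad is chosen for [a], the sides of its neighbours shrink by a factor
[rho] at most, and induction applies. *)
Lemma partial_copies_lower_bound k : forall (A : {set 'I_h}) (b : 'I_h -> {set T}), #|A| = k ->
    (forall l, l \in A -> b l \subset b0 l) ->
    (forall l, l \in A -> 2 * h%:R * eta * m l <= rho ^+ k * #|b l|%:R) ->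
  (rho ^+ h / 2) ^+ k * #|box b|%:R <= #|partial_copies A b|%:R.
Proof.
elim: k => [|k IH] A b cA sb big.
  rewrite expr0 mul1r ler_nat; apply/subset_leq_card/subsetP => v vb.
  rewrite inE vb /=; apply/forall_inP => i.
  by move/eqP: cA; rewrite cards_eq0 => /eqP ->; rewrite inE.
have [a aA] : exists a, a \in A by apply/card_gt0P; rewrite cA.
pose A' := A :\ a; have cA' : #|A'| = k by move: cA; rewrite (cardsD1 a) aA => -[].
pose nb x j := [set y in b j | [set x; y] \in C].
pose bad j := [set x in b a | (#|nb x j|%:R < rho * #|b j|%:R)].
have rhok : rho ^+ k.+1 <= 1 by rewrite exprn_ile1 // ltW.
have big1 l : l \in A -> 2 * h%:R * eta * m l <= #|b l|%:R.
  by move=> /big /le_trans; apply; rewrite ler_piMl.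
have h1 : 1 <= h%:R :> R by rewrite ler1n (leq_ltn_trans (leq0n a)).
have etabig l : l \in A -> eta * m l <= #|b l|%:R.
  move=> /big1; apply: le_trans; rewrite -!mulrA.
  have := m_ge0 l; set ml := m l => ml0.
  have : 0 <= eta * ml by rewrite mulr_ge0.
  set z := eta * ml => z0.
  have : 0 <= (h%:R - 1) * z by rewrite mulr_ge0 // subr_ge0.
  lra.
have badP j : j \in A' -> [set a; j] \in E -> #|bad j|%:R <= eta * m a.
  rewrite !inE => /andP[ja jA] ajE; rewrite leNgt; apply/negP => lt.
  have sbad : bad j \subset b0 a.
    by apply: subset_trans (sb _ aA); apply/subsetP => x; rewrite inE => /andP[].
  have := dense _ ajE sbad (sb _ jA) (ltW lt) (etabig _ jA).
  rewrite eq_sym => /(_ ja); rewrite leNgt => /negP; apply.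
  have -> : pair_count C (bad j) (b j) = (\sum_(x in bad j) #|nb x j|)%N.
    apply: eq_bigr => x _; rewrite -sum1dep_card big_mkcondr /=.
    by apply: eq_bigr => y _; case: ifP.
  rewrite natr_sum mulrCA [ltRHS]mulr_natl -sumr_const.
  have [x xbad] : exists x, x \in bad j.
    apply/card_gt0P; rewrite -(ltr_nat R).
    by apply: le_lt_trans lt; rewrite mulr_ge0.
  rewrite (bigD1 x) //= [ltRHS](bigD1 x) //=; apply: ltr_leD.
    by move: xbad; rewrite inE => /andP[].
  by apply: ler_sum => y /andP[]; rewrite inE => /andP[_ /ltW].
pose X := b a :\: \bigcup_(j in A' | [set a; j] \in E) bad j.
have cX : #|b a|%:R / 2 <= #|X|%:R :> R.
  have cU : #|\bigcup_(j in A' | [set a; j] \in E) bad j|%:R <= h%:R * (eta * m a).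
    apply: (@le_trans _ _ (\sum_(j in A' | [set a; j] \in E) #|bad j|%:R)).
      by rewrite -natr_sum ler_nat leq_card_bigcup.
    apply: (@le_trans _ _ (\sum_(j : 'I_h) eta * m a)).
      rewrite big_mkcond /=; apply: ler_sum => j _.
      by case: ifP => [/andP[]|_]; [exact: badP|rewrite mulr_ge0].
    by rewrite sumr_const card_ord mulr_natl.
  have : #|b a|%:R <= #|X|%:R + #|\bigcup_(j in A' | [set a; j] \in E) bad j|%:R :> R.
    rewrite -natrD ler_nat addnC -leq_subLR /X cardsD leq_sub2l //.
    exact/subset_leq_card/subsetIr.
  have := big1 _ aA; lra.
pose bx x l := if l == a then [set x] else
  if (l \in A') && ([set a; l] \in E) then nb x l else b l.
have bx_big x l : x \in X -> l != a -> rho * #|b l|%:R <= #|bx x l|%:R.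
  rewrite inE => /andP[xNbad xb] la; rewrite /bx (negbTE la).
  case: ifP => [lA|_]; last by rewrite ler_piMl.
  rewrite leNgt; apply: contra xNbad => lt; apply/bigcupP; exists l => //.
  by rewrite inE xb.
have step x : x \in X -> (rho ^+ h / 2) ^+ k * (rho ^+ h *
    (\prod_(l | l != a) #|b l|)%:R) <= #|partial_copies A' (bx x)|%:R.
  move=> xX; have nbsub l : nb x l \subset b l.
    by apply/subsetP => y; rewrite inE => /andP[].
  apply: le_trans (IH A' (bx x) cA' _ _); first last.
  - move=> l lA'; have := lA'; rewrite !inE => /andP[la lA].
    apply: le_trans (big _ lA) _; rewrite exprSr -mulrA ler_pM2l ?exprn_gt0 //.
    exact: bx_big.
  - move=> l lA'; have := lA'; rewrite !inE => /andP[la lA].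
    rewrite /bx (negbTE la); case: ifP => _; last exact: sb.
    exact: subset_trans (sb _ lA).
  - apply: ler_wpM2l; first by positivity.
    rewrite card_box [X in _ <= X%:R](bigD1 a) //= {1}/bx eqxx cards1 mul1n !natr_prod.
    apply: (@le_trans _ _ (\prod_(l | l != a) (rho * #|b l|%:R))).
      rewrite big_split /= ler_wpM2r ?prodr_ge0 // prodr_const.
      apply: ler_wiXn2l => //; first exact: ltW.
      by rewrite -[leqRHS]card_ord max_card.
    apply: ler_prod => l la; rewrite bx_big // andbT.
    by rewrite mulr_ge0 // ltW.
have sum : (\sum_(x in X) #|partial_copies A' (bx x)| <= #|partial_copies A b|)%N.
  rewrite -[leqRHS]sum1_card.
  rewrite (bigID (fun v : {ffun 'I_h -> T} => v a \in X)) /=.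
  apply: leq_trans (leq_addr _ _).
  rewrite (partition_big (fun v : {ffun 'I_h -> T} => v a) (mem X)) /=; last first.
    by move=> v /andP[].
  apply: leq_sum => x xX; rewrite sum1dep_card; apply/subset_leq_card/subsetP => v.
  case/setIdP => /boxP vbx /forall_inP vcop.
  have va : v a = x by have := vbx a; rewrite /bx eqxx inE => /eqP.
  have vb : v \in box b.
    apply/boxP => l; have := vbx l; rewrite /bx.
    case: eqVneq => [->|_]; last by case: ifP => // _; rewrite inE; case/andP.
    by rewrite inE => /eqP->; move: xX; rewrite inE => /andP[].
  have vnb l : l != a -> l \in A -> [set a; l] \in E -> [set x; v l] \in C.
    move=> la lA laE; have := vbx l; rewrite /bx (negbTE la) laE andbT.
    by rewrite in_setD1 la lA /= => /setIdP[].
  rewrite inE va eqxx xX !andbT; apply/setIdP; split=> //.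
  apply/forall_inP => i iA; apply/forall_inP => j jA; apply/implyP => /andP[ij ijE].
  have [ia|ia] := eqVneq i a.
    by rewrite ia va vnb // -?ia // eq_sym.
  have [ja|ja] := eqVneq j a.
    by rewrite ja va setUC vnb // setUC -ja.
  have iA' : i \in A' by rewrite !inE ia.
  have jA' : j \in A' by rewrite !inE ja.
  by have /forall_inP/(_ j jA')/implyP := vcop i iA'; apply; rewrite ij.
apply: (@le_trans _ _ (\sum_(x in X) #|partial_copies A' (bx x)|)%:R); last first.
  by rewrite ler_nat.
rewrite natr_sum.
apply: (@le_trans _ _ (\sum_(x in X) (rho ^+ h / 2) ^+ k * (rho ^+ h *
    (\prod_(l | l != a) #|b l|)%:R))); last exact: ler_sum.
rewrite sumr_const -[leRHS]mulr_natl card_box (bigD1 a) //= natrM.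
set P := (\prod_(l | _) _)%:R; set Q := (rho ^+ h / 2) ^+ k.
rewrite exprS -/Q.
have : 0 <= Q * (rho ^+ h * P) * (#|X|%:R - #|b a|%:R / 2).
  by rewrite mulr_ge0 ?subr_ge0 // /Q /P; positivity.
lra.
Qed.

End Embedding.

(** * Sets with few copies are sparse on a large part of some colour *)

Section Sparse.
Variables (R : realFieldType) (T : finType) (h : nat) (E : {set {set 'I_h}}).
Hypothesis E2 : forall e, e \in E -> #|e| = 2%N.
Implicit Types (b : 'I_h -> {set T}) (C G : {set {set T}}) (U W : {set T}).

Lemma sparse_pair C b (rho eta : R) : 0 < rho -> rho <= 1 -> (0 < h)%N ->
    2 * h%:R * eta = rho ^+ h ->
    #|[set v in box b | [forall e in E, v @: e \in C]]|%:R
      < (rho ^+ h / 2) ^+ h * #|box b|%:R ->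
  exists i j U W, [/\ i != j, [set i; j] \in E, U \subset b i, W \subset b j &
    [/\ eta * #|b i|%:R <= #|U|%:R, eta * #|b j|%:R <= #|W|%:R &
     (pair_count C U W)%:R < rho * (#|U|%:R * #|W|%:R)]].
Proof.
move=> rho0 rho1 h0 etaE few; apply: contrapT => nosparse.
have dense i j U W : i != j -> [set i; j] \in E -> U \subset b i ->
  W \subset b j -> eta * #|b i|%:R <= #|U|%:R -> eta * #|b j|%:R <= #|W|%:R ->
  rho * (#|U|%:R * #|W|%:R) <= (pair_count C U W)%:R.
  move=> ij ijE sU sW bU bW; rewrite leNgt; apply/negP => lt.
  by apply: nosparse; exists i, j, U, W.
have eta0 : 0 <= eta.
  have : 0 < 2 * h%:R * eta by rewrite etaE exprn_gt0.
  by rewrite pmulr_rgt0 ?mulr_gt0 ?ltr0n // => /ltW.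
have := @partial_copies_lower_bound R T h E C b (fun l => #|b l|%:R) rho eta rho0 rho1 eta0
  (fun l => ler0n _ _) dense h setT b.
rewrite cardsT card_ord => /(_ erefl (fun _ _ => subxx _)) H.
have := few; rewrite ltNge => /negP; apply.
apply: le_trans (H _) _; first by rewrite etaE.
rewrite ler_nat; apply/subset_leq_card/subsetP => v /setIdP[vb /forall_inP vcop].
apply/setIdP; split=> //; apply/forall_inP => e eE.
have /eqP/cards2P[i [j [ij eij]]] := E2 eE; rewrite eij imset_pair.
have ijE : [set i; j] \in E by rewrite -eij.
have /forall_inP/(_ j (in_setT _))/implyP H' := vcop i (in_setT _).
by apply: H'; rewrite ij ijE.
Qed.

(** The only consequence of regularity that is used: large subsets of adjacent parts
span a positive proportion of the expected number of edges. *)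
Definition lower_dense (V : 'I_h -> {set T}) (n : nat) (kappa p : R) G : Prop :=
  forall i j U W, i != j -> [set i; j] \in E -> U \subset V i -> W \subset V j ->
  kappa * n%:R <= #|U|%:R -> kappa * n%:R <= #|W|%:R ->
  p * (#|U|%:R * #|W|%:R) <= (pair_count G U W)%:R.

Section Decomposition.
Variables (V : 'I_h -> {set T}) (n : nat) (C : {set {set T}}).
Variables (rho eta theta p : R).
Hypotheses (cardV : forall l, #|V l| = n) (theta_ge0 : 0 <= theta).
Hypotheses (eta_ge0 : 0 <= eta) (eta_le1 : eta <= 1).

Hypothesis sparse : forall b, (forall l, b l \subset V l) ->
    (forall l, theta * n%:R <= #|b l|%:R) ->
  exists i j U W, [/\ i != j, [set i; j] \in E, U \subset b i, W \subset b j &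
    [/\ eta * #|b i|%:R <= #|U|%:R, eta * #|b j|%:R <= #|W|%:R &
     (pair_count C U W)%:R < rho * (#|U|%:R * #|W|%:R)]].

(** When [B] is a union of boxes, [hits B e] counts the pairs of a set [G], weighted by
the number of tuples of [B] projecting to them. Unlike densities, these weighted
counts are additive in [B]. *)
Definition hits (B : {set {ffun 'I_h -> T}}) (e : {set 'I_h}) G : nat :=
  #|[set v : {ffun 'I_h -> T} in B | v @: e \in G]|.

Lemma hitsU (B1 B2 : {set {ffun 'I_h -> T}}) (e : {set 'I_h}) G : [disjoint B1 & B2] ->
  hits (B1 :|: B2) e G = (hits B1 e G + hits B2 e G)%N.
Proof.
move=> dis; rewrite /hits -cardsUI [X in (_ + #|pred_of_set X|)%N]disjoint_setI0.
  rewrite cards0 addn0; congr #|pred_of_set _|; apply/setP => v.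
  by rewrite !inE andb_orl.
by apply: disjointWl (disjointWr _ dis); apply/subsetP => v /setIdP[].
Qed.

Lemma cardsU_disjoint (A B : {set {ffun 'I_h -> T}}) : [disjoint A & B] ->
  #|A :|: B| = (#|A| + #|B|)%N.
Proof. by move=> /disjoint_setI0 dis; rewrite cardsU dis cards0 subn0. Qed.

Lemma disjoint_setUr (A B1 B2 : {set {ffun 'I_h -> T}}) :
  [disjoint A & B1] -> [disjoint A & B2] -> [disjoint A & B1 :|: B2].
Proof. by rewrite -!setI_eq0 setIUr => /eqP-> /eqP->; rewrite setU0. Qed.

(** A box with a thin side is given up. Otherwise it contains a sparse pair of sides
[U], [W], and splits into the box with these two sides, which is assigned to the
edge [ij], and two more boxes that are treated recursively. At each level of the
recursion the volume that is not covered decreases by the factor [1 - eta ^ 2],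
and there are at most [2 ^ k] thin boxes in the end. *)
Lemma box_decomposition k : forall b, (forall l, b l \subset V l) ->
  exists B : {set 'I_h} -> {set {ffun 'I_h -> T}},
  [/\ forall e, B e \subset box b,
      #|box b|%:R <= \sum_(e in E) #|B e|%:R
         + ((1 - eta ^+ 2) ^+ k * #|box b|%:R + 2 ^+ k * theta * n%:R ^+ h),
      forall e, e \in E -> (hits (B e) e C)%:R <= rho * #|B e|%:R &
      forall e G, e \in E -> lower_dense V n (eta * theta) p G ->
        p * #|B e|%:R <= (hits (B e) e G)%:R].
Proof.
have hits0 (e : {set 'I_h}) G : hits set0 e G = 0%N.
  by apply/eqP; rewrite cards_eq0; apply/eqP/setP => v; rewrite !inE.
elim: k => [|k IH] b sb.
  exists (fun=> set0); split=> //.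
  - by move=> e; apply: sub0set.
  - rewrite expr0 mul1r big1 ?add0r => [|e _]; last by rewrite cards0.
    by rewrite lerDl mulr_ge0 ?mulr_ge0 ?exprn_ge0.
  - by move=> e _; rewrite hits0 cards0 mulr0.
  - by move=> e G _ _; rewrite cards0 mulr0.
have eta2_le1 : eta ^+ 2 <= 1 by rewrite exprn_ile1.
have [/existsP[l thin]|] := boolP [exists l, #|b l|%:R < theta * n%:R].
  exists (fun=> set0); split=> //.
  - by move=> e; apply: sub0set.
  - rewrite big1 ?add0r => [|e _]; last by rewrite cards0.
    apply: (@le_trans _ _ (2 ^+ k.+1 * theta * n%:R ^+ h)); last first.
      by rewrite lerDr mulr_ge0 // exprn_ge0 // subr_ge0.
    apply: (@le_trans _ _ (theta * n%:R ^+ h)); last first.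
      rewrite -mulrA ler_peMl ?mulr_ge0 ?exprn_ge0 //.
      by rewrite exprn_ege1 // ler1n.
    rewrite card_box (bigD1 l) //= natrM.
    have -> : n%:R ^+ h = n%:R * n%:R ^+ h.-1 :> R.
      by rewrite -exprS prednK // (leq_ltn_trans (leq0n l)).
    rewrite mulrA ler_pM ?(ltW thin) // -natrX ler_nat.
    have -> : (n ^ h.-1 = \prod_(l' < h | l' != l) n)%N.
      by rewrite prod_nat_const cardC1 card_ord.
    by apply: leq_prod => i _; rewrite -(cardV i) subset_leq_card.
  - by move=> e _; rewrite hits0 cards0 mulr0.
  - by move=> e G _ _; rewrite cards0 mulr0.
rewrite negb_exists => /forallP fat.
have {}fat l : theta * n%:R <= #|b l|%:R by rewrite leNgt.
have [i [j [U [W [ij ijE sU sW [bU bW sparseUW]]]]]] := sparse sb fat.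
pose b1 := upd b i (b i :\: U).
pose b2 := upd (upd b i U) j (b j :\: W).
pose b3 := upd (upd b i U) j W.
have sub1 l : b1 l \subset b l.
  by rewrite /b1 /upd; case: eqVneq => [->|//]; apply: subsetDl.
have sub2 l : b2 l \subset b l.
  rewrite /b2 /upd; case: eqVneq => [->|_]; first exact: subsetDl.
  by case: eqVneq => [->|//].
have sub3 l : b3 l \subset b l.
  by rewrite /b3 /upd; case: eqVneq => [->//|_]; case: eqVneq => [->|//].
have boxS b' : (forall l, b' l \subset b l) -> box b' \subset box b.
  by move=> sb'; apply/subsetP => v /boxP vb'; apply/boxP => l; apply: (subsetP (sb' l)).
have b2i : b2 i = U by rewrite /b2 upd_other // upd_same.
have b3i : b3 i = U by rewrite /b3 upd_other // upd_same.
have b2j : b2 j = b j :\: W by rewrite /b2 upd_same.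
have b3j : b3 j = W by rewrite /b3 upd_same.
have dis12 : [disjoint box b1 & box b2].
  rewrite -setI_eq0; apply/eqP/setP => v; rewrite !in_setI in_set0.
  apply/negP => /andP[/boxP/(_ i) v1 /boxP/(_ i)]; rewrite b2i => vU.
  by move: v1; rewrite /b1 upd_same inE vU.
have dis13 : [disjoint box b1 & box b3].
  rewrite -setI_eq0; apply/eqP/setP => v; rewrite !in_setI in_set0.
  apply/negP => /andP[/boxP/(_ i) v1 /boxP/(_ i)]; rewrite b3i => vU.
  by move: v1; rewrite /b1 upd_same inE vU.
have dis23 : [disjoint box b2 & box b3].
  rewrite -setI_eq0; apply/eqP/setP => v; rewrite !in_setI in_set0.
  apply/negP => /andP[/boxP/(_ j) v1 /boxP/(_ j)]; rewrite b3j => vU.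
  by move: v1; rewrite b2j inE vU.
have [B1 [B1s B1c B1C B1G]] := IH b1 (fun l => subset_trans (sub1 l) (sb l)).
have [B2 [B2s B2c B2C B2G]] := IH b2 (fun l => subset_trans (sub2 l) (sb l)).
pose B3 (e : {set 'I_h}) := if e == [set i; j] then box b3 else set0.
have B3s (e : {set 'I_h}) : B3 e \subset box b3.
  by rewrite /B3; case: ifP => // _; apply: sub0set.
pose B (e : {set 'I_h}) := B1 e :|: (B2 e :|: B3 e).
have d23 (e : {set 'I_h}) : [disjoint B2 e & B3 e].
  by apply: disjointWl (disjointWr _ dis23).
have d1 (e : {set 'I_h}) : [disjoint B1 e & B2 e :|: B3 e].
  apply: disjoint_setUr; apply: disjointWl (B1s e) _.
    exact: disjointWr (B2s e) dis12.
  exact: disjointWr (B3s e) dis13.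
have cB (e : {set 'I_h}) : #|B e| = (#|B1 e| + (#|B2 e| + #|B3 e|))%N.
  by rewrite /B !cardsU_disjoint.
have hB (e : {set 'I_h}) G : hits (B e) e G
    = (hits (B1 e) e G + (hits (B2 e) e G + hits (B3 e) e G))%N.
  by rewrite /B !hitsU.
have UW0 : 0 < #|U|%:R * #|W|%:R :> R.
  rewrite lt_def mulr_ge0 // andbT; apply/eqP => UW0.
  by move: sparseUW; rewrite UW0 mulr0 ltNge ler0n.
have hB3 G : (hits (box b3) [set i; j] G)%:R * (#|U|%:R * #|W|%:R)
     = (pair_count G U W)%:R * #|box b3|%:R :> R.
  have := box_pair_count G b3 ij; rewrite b3i b3j => H.
  rewrite -!natrM -H; congr ((_ * _)%N%:R); congr #|pred_of_set _|.
  by apply/setP => v; rewrite !inE imset_pair.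
exists B; split.
- move=> e; rewrite /B !subUset.
  rewrite (subset_trans (B1s e) (boxS _ sub1)) (subset_trans (B2s e) (boxS _ sub2)).
  exact: subset_trans (B3s e) (boxS _ sub3).
- have boxE : #|box b|%:R = #|box b1|%:R + #|box b2|%:R + #|box b3|%:R :> R.
    rewrite -!natrD -!addnA -cardsU_disjoint // -cardsU_disjoint; last first.
      exact: disjoint_setUr.
    congr (#|pred_of_set _|%:R); apply/setP => v; rewrite in_setU in_setU.
    apply/idP/idP => [/boxP vb|/orP[|/orP[]]]; try by apply/subsetP/boxS.
    have [vU|vU] := boolP (v i \in U); last first.
      apply/orP; left; apply/boxP => l; rewrite /b1 /upd.
      by case: eqVneq => [->|_ //]; rewrite inE vU vb.
    apply/orP; right; have [vW|vW] := boolP (v j \in W).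
      apply/orP; right; apply/boxP => l; rewrite /b3 /upd.
      by case: eqVneq => [->//|_]; case: eqVneq => [->|].
    apply/orP; left; apply/boxP => l; rewrite /b2 /upd.
    by case: eqVneq => [->//|_]; [rewrite inE vW vb|case: eqVneq => [->|]].
  have sumE : \sum_(e in E) #|B e|%:R = \sum_(e in E) #|B1 e|%:R
       + \sum_(e in E) #|B2 e|%:R + #|box b3|%:R :> R.
    rewrite -big_split /= [in RHS](bigD1 [set i; j]) //= [LHS](bigD1 [set i; j]) //=.
    have -> : \sum_(e in E | e != [set i; j]) #|B e|%:R =
       \sum_(e in E | e != [set i; j]) (#|B1 e|%:R + #|B2 e|%:R) :> R.
      apply: eq_bigr => e /andP[_ /negbTE ne].
      by rewrite cB /B3 ne cards0 addn0 natrD.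
    by rewrite cB /B3 eqxx !natrD; ring.
  have b3big : eta ^+ 2 * #|box b|%:R <= #|box b3|%:R.
    pose rest := (\prod_(l | (l != i) && (l != j)) #|b l|)%N.
    have -> : #|box b| = (#|b i| * (#|b j| * rest))%N.
      by rewrite card_box (bigD1 i) //= (bigD1 j) 1?eq_sym.
    have -> : #|box b3| = (#|U| * (#|W| * rest))%N.
      rewrite card_box (bigD1 i) //= (bigD1 j) 1?eq_sym //= b3i b3j.
      congr (_ * (_ * _))%N.
      by apply: eq_bigr => l /andP[li lj]; rewrite /b3 !upd_other.
    have -> : eta ^+ 2 * (#|b i| * (#|b j| * rest))%:R =
        (eta * #|b i|%:R) * ((eta * #|b j|%:R) * rest%:R).
      by rewrite !natrM; ring.
    by rewrite !natrM ler_pM ?mulr_ge0 // ler_wpM2r.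
  set x := (1 - eta ^+ 2) ^+ k in B1c B2c.
  have x0 : 0 <= x by rewrite exprn_ge0 // subr_ge0.
  rewrite sumE !(exprS _ k) -/x.
  have : 0 <= x * (#|box b3|%:R - eta ^+ 2 * #|box b|%:R).
    by rewrite mulr_ge0 // subr_ge0.
  rewrite boxE in b3big *; move: B1c B2c; lra.
- move=> e eE; rewrite hB cB !natrD !mulrDr lerD ?B1C // lerD ?B2C // /B3.
  case: eqVneq => [->|_]; last by rewrite hits0 cards0 mulr0.
  rewrite -(ler_pM2r UW0) hB3 mulrAC ler_wpM2r //; exact: ltW.
- move=> e G eE dG; rewrite hB cB !natrD !mulrDr lerD ?B1G // lerD ?B2G // /B3.
  case: eqVneq => [->|_]; last by rewrite cards0 mulr0.
  rewrite -(ler_pM2r UW0) hB3 mulrAC ler_wpM2r //.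
  apply: (dG i j) => //; [exact: subset_trans sU (sb i)|exact: subset_trans sW (sb j)|..].
    by apply: le_trans bU; rewrite -mulrA ler_wpM2l.
  by apply: le_trans bW; rewrite -mulrA ler_wpM2l.
Qed.

End Decomposition.
End Sparse.

(** * Partite structure and level sets *)

Lemma small_power (R : realType) (y : R) : 0 < y -> y <= 1 ->
  exists k, (1 - y) ^+ k <= 1 / 4.
Proof.
move=> y0 y1; have bern k : (1 - y) ^+ k * (1 + k%:R * y) <= 1.
  elim: k => [|k IH]; first by rewrite expr0 mul0r addr0 mulr1.
  apply: le_trans IH; rewrite exprSr -mulrA; apply: ler_wpM2l.
    by rewrite exprn_ge0 // subr_ge0.
  have : 0 <= k%:R * y * y + y * y by positivity.
  rewrite -natr1; lra.
pose k := Num.bound (3 / y); exists k.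
have : 3 / y < k%:R by apply: archi_boundP; positivity.
rewrite ltr_pdivrMr // => ky.
have q0 : 0 <= (1 - y) ^+ k by rewrite exprn_ge0 // subr_ge0.
have : 0 <= (1 - y) ^+ k * (k%:R * y - 3) by rewrite mulr_ge0 // subr_ge0 ltW.
have := bern k; lra.
Qed.

Section Partite.
Variables (T : finType) (h n : nat) (V : 'I_h -> {set T}).
Hypotheses (cardV : forall l, #|V l| = n).
Hypothesis disV : forall l l' y, y \in V l -> y \in V l' -> l = l'.

Lemma image_inj (v s : {ffun 'I_h -> T}) (e : {set 'I_h}) l :
  v \in box V -> s \in box V -> v @: e = s @: e -> l \in e -> v l = s l.
Proof.
move=> /boxP vV /boxP sV vs le.
have : v l \in s @: e by rewrite -vs imset_f.
case/imsetP => l' _ vl.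
by rewrite vl (disV (vV l) (l' := l')) // vl.
Qed.

(** As the parts are disjoint, [v @: e = s @: e] determines [v] on [e]; the remaining
[h - #|cover J|] entries are free. *)
Lemma extension_count (J : {set {set 'I_h}}) (s : {ffun 'I_h -> T}) :
  (#|[set v in box V | [forall e in J, v @: e == s @: e]]|
     <= n ^ (h - #|cover J|))%N.
Proof.
have [->|[u]] := set_0Vmem [set v in box V | [forall e in J, v @: e == s @: e]].
  by rewrite cards0.
case/setIdP => uV /forall_inP us.
pose b l := if l \in cover J then [set u l] else V l.
apply: (@leq_trans #|box b|).
  apply/subset_leq_card/subsetP => v /setIdP[vV /forall_inP vs].
  apply/boxP => l; rewrite /b; case: ifP => [/bigcupP[e eJ le]|_].
    rewrite inE; apply/eqP; apply: image_inj (le) => //.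
    by rewrite (eqP (vs _ eJ)) (eqP (us _ eJ)).
  by move/boxP: vV.
rewrite card_box (bigID (mem (cover J))) /=.
rewrite big1 ?mul1n => [|l lJ]; last by rewrite /b lJ cards1.
rewrite (eq_bigr (fun=> n)) => [|l /negbTE lJ]; last by rewrite /b lJ.
rewrite prod_nat_const (_ : #|[pred l | l \notin cover J]| = #|~: cover J|).
  by rewrite cardsCs setCK card_ord.
by apply: eq_card => l; rewrite !inE.
Qed.

Definition part (e : {set 'I_h}) : {set {set T}} :=
  (fun v : {ffun 'I_h -> T} => v @: e) @: box V.

End Partite.

(** The weight of a pair [x] of colour [e] is the number of tuples of the
decomposition that are assigned to [e] and project to [x]; it is at most
[n ^ (h - 2)], and [Z] consists of the pairs whose weight is at least the proportion
[1 / (8 #|E|)] of this. A regular graph has weight at least twice what its pairs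
outside [Z] can contribute, whereas [C] has small total weight. The bound on
[#|G :&: Z|] involves only [M] and [#|E|], while that on [#|C :&: Z|] tends to 0 with
[rho]. *)
Lemma sparse_level_set (R : realType) (h : nat) (E : {set {set 'I_h}}) (rho : R) :
    (forall e, e \in E -> #|e| = 2%N) -> E != set0 -> 0 < rho -> rho <= 1 ->
  exists2 eps : R, 0 < eps & exists2 kappa : R, 0 < kappa &
  forall (T : finType) (V : 'I_h -> {set T}) (n : nat) (C : {set {set T}})
    (p : R) (M : nat),
    (forall l, #|V l| = n) -> (0 < n)%N ->
    (forall l l' y, y \in V l -> y \in V l' -> l = l') ->
    M%:R / 2 <= p * n%:R ^+ 2 -> 0 <= p ->
    #|[set v in box V | [forall e in E, v @: e \in C]]|%:R < eps * n%:R ^+ h ->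
  exists2 e, e \in E & exists Z : {set {set T}},
    [/\ Z \subset part V e,
        #|C :&: Z|%:R <= 8 * #|E|%:R * rho * n%:R ^+ 2 &
        forall G : {set {set T}},
          lower_dense E V n kappa p G -> (#|G :&: part V e| <= M)%N ->
          M%:R / (8 * #|E|%:R) <= #|G :&: Z|%:R :> R].
Proof.
move=> E2 /set0Pn[e0 e0E] rho0 rho1.
have h0 : (0 < h)%N.
  have /eqP/cards2P[i _] := E2 _ e0E; exact: leq_ltn_trans (ltn_ord i).
have h2 : (2 <= h)%N by rewrite -(E2 _ e0E) -[leqRHS]card_ord max_card.
have q0 : 0 < #|E|%:R :> R by rewrite ltr0n; apply/card_gt0P; exists e0.
have h1R : 1 <= h%:R :> R by rewrite ler1n.
pose eta := rho ^+ h / (2 * h%:R).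
have hR0 : 0 < h%:R :> R by rewrite ltr0n.
have eta0 : 0 < eta by rewrite /eta; positivity.
have etaE : 2 * h%:R * eta = rho ^+ h by rewrite /eta; field; rewrite gt_eqF.
have rhoh : rho ^+ h <= 1 by rewrite exprn_ile1 // ltW.
have eta1 : eta <= 1.
  by rewrite /eta ler_pdivrMr ?mul1r; [lra|positivity].
have [k small] : exists k, (1 - eta ^+ 2) ^+ k <= 1 / 4.
  by apply: small_power; [positivity|rewrite exprn_ile1 // ltW].
(* [theta] makes the [2 ^ k] thin boxes cover a quarter of the volume at most. *)
pose theta : R := 1 / (4 * 2 ^+ k).
have theta0 : 0 < theta by rewrite /theta; positivity.
exists ((rho ^+ h / 2) ^+ h * theta ^+ h); first by positivity.
exists (eta * theta); first by positivity.
move=> T V n C p M cardV n0 disV pM p0 few.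
have nR0 : 0 < n%:R :> R by rewrite ltr0n.
have sparse (b : 'I_h -> {set T}) : (forall l, b l \subset V l) ->
    (forall l, theta * n%:R <= #|b l|%:R) ->
  exists i j (U W : {set T}), [/\ i != j, [set i; j] \in E, U \subset b i, W \subset b j &
    [/\ eta * #|b i|%:R <= #|U|%:R, eta * #|b j|%:R <= #|W|%:R &
     (pair_count C U W)%:R < rho * (#|U|%:R * #|W|%:R)]].
  move=> sb fat; apply: sparse_pair => //.
  apply: (@le_lt_trans _ _ (#|[set v in box V | [forall e in E, v @: e \in C]]|%:R)).
    rewrite ler_nat; apply/subset_leq_card/subsetP => v /setIdP[/boxP vb vC].
    by apply/setIdP; split=> //; apply/boxP => l; apply: (subsetP (sb l)).
  apply: lt_le_trans few _; rewrite -mulrA; apply: ler_wpM2l; first by positivity.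
  rewrite -exprMn card_box natr_prod -[X in _ ^+ X]card_ord -prodr_const.
  by apply: ler_prod => l _; rewrite fat andbT; positivity.
have [B [Bs Bc BC BG]] := @box_decomposition R T h E V n C rho eta theta p cardV
   (ltW theta0) (ltW eta0) eta1 sparse k V (fun l => subxx _).
have cV : #|box V|%:R = n%:R ^+ h :> R.
  rewrite card_box (eq_bigr (fun=> n)) // prod_nat_const card_ord.
  by rewrite natrX.
pose w : R := n%:R ^+ (h - 2).
have wE : n%:R ^+ h = n%:R ^+ 2 * w by rewrite -exprD subnKC.
have w0 : 0 < w by rewrite /w; positivity.
have [e eE Be] : exists2 e, e \in E & n%:R ^+ h / (2 * #|E|%:R) <= #|B e|%:R :> R.
  apply: contrapT => no.
  have lt e : e \in E -> #|B e|%:R < n%:R ^+ h / (2 * #|E|%:R) :> R.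
    by move=> eE; rewrite ltNge; apply/negP => le; apply: no; exists e.
  have : \sum_(e in E) #|B e|%:R < \sum_(e in E) n%:R ^+ h / (2 * #|E|%:R) :> R.
    rewrite (bigD1 e0) //= [ltRHS](bigD1 e0) //=; apply: ltr_leD; first exact: lt.
    by apply: ler_sum => e /andP[/lt/ltW].
  rewrite sumr_const -[ltRHS]mulr_natl.
  have -> : #|E|%:R * (n%:R ^+ h / (2 * #|E|%:R)) = n%:R ^+ h / 2 :> R.
    by field; rewrite gt_eqF.
  move: Bc; rewrite cV.
  have -> : 2 ^+ k * theta = 1 / 4.
    by rewrite /theta; field; rewrite expf_neq0 // pnatr_eq0.
  have nh0 : 0 < n%:R ^+ h :> R by positivity.
  have : 0 <= (1 / 4 - (1 - eta ^+ 2) ^+ k) * n%:R ^+ h.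
    by rewrite mulr_ge0 ?subr_ge0 // ltW.
  lra.
exists e => //.
pose f x := #|[set v in B e | v @: e == x]|.
have BV : B e \subset box V by [].
have fw x : (f x)%:R <= w.
  rewrite /w -natrX ler_nat /f.
  have [->|[s /setIdP[_ /eqP sx]]] := set_0Vmem [set v in B e | v @: e == x].
    by rewrite cards0.
  rewrite -(E2 e eE); have := extension_count cardV disV [set e] s.
  rewrite cover1; apply: leq_trans; apply/subset_leq_card/subsetP => v.
  case/setIdP => /(subsetP BV) vV /eqP vx; apply/setIdP; split=> //.
  by apply/forall_inP => e'; rewrite inE => /eqP->; rewrite vx sx.
have hitsE G : hits (B e) e G = (\sum_(x in G :&: part V e) f x)%N.
  rewrite /hits -sum1dep_card.
  rewrite (partition_big (fun v : {ffun 'I_h -> T} => v @: e) (mem (G :&: part V e))) /=.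
    apply: eq_bigr => x /setIP[xG _]; rewrite sum1dep_card.
    by apply: eq_card => v; rewrite !inE -andbA; congr (_ && _);
       case: eqP => [->|//]; rewrite ?xG ?andbF.
  by move=> v /andP[vB vG]; rewrite inE vG imset_f // (subsetP BV).
pose Z := [set x in part V e | w / (8 * #|E|%:R) <= (f x)%:R].
exists Z; split.
- by apply/subsetP => x /setIdP[].
- have H : #|C :&: Z|%:R * (w / (8 * #|E|%:R)) <= (hits (B e) e C)%:R.
    rewrite hitsE natr_sum mulr_natl -sumr_const.
    rewrite big_mkcond [leRHS]big_mkcond /=; apply: ler_sum => x _.
    rewrite !in_setI inE; case: (x \in C) => //=.
    by case: (x \in part V e) => //=; case: ifP.
  have H2 := le_trans H (BC e eE).
  have H3 : rho * #|B e|%:R <= rho * (n%:R ^+ 2 * w).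
    rewrite ler_pM2l // -wE -cV ler_nat; exact: subset_leq_card.
  have := le_trans H2 H3.
  rewrite mulrA ler_pdivrMr; last by positivity.
  rewrite mulrA mulrAC ler_pM2r //; lra.
- move=> G dG GM.
  have H := BG e G eE dG.
  have H2 : (hits (B e) e G)%:R <= #|G :&: Z|%:R * w + M%:R * (w / (8 * #|E|%:R)).
    rewrite hitsE (bigID (mem Z)) /= natrD; apply: lerD.
      rewrite natr_sum.
      apply: (@le_trans _ _ (\sum_(x in G :&: Z) w)); last first.
        by rewrite sumr_const mulr_natl.
      rewrite big_mkcond [leRHS]big_mkcond /=; apply: ler_sum => x _.
      rewrite !in_setI [in leLHS]andbAC; case: (x \in G) => //=.
      case: (x \in Z) => //=; by case: ifP => // _; rewrite ltW.
    rewrite natr_sum.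
    apply: (@le_trans _ _ (\sum_(x in G :&: part V e) (w / (8 * #|E|%:R)))).
      rewrite big_mkcond [leRHS]big_mkcond /=; apply: ler_sum => x _.
      have [/=|] := boolP (x \in G :&: part V e) => //= /setIP[_ xp].
      by case: ifP => [|_]; [rewrite inE xp -ltNge => /ltW|positivity].
    rewrite sumr_const -[leLHS]mulr_natl ler_wpM2r ?ler_nat //.
    by positivity.
  have H3 : p * (n%:R ^+ h / (2 * #|E|%:R)) <= p * #|B e|%:R by rewrite ler_wpM2l.
  have H4 : M%:R / 2 * (w / (2 * #|E|%:R)) <= p * (n%:R ^+ h / (2 * #|E|%:R)).
    have -> : p * (n%:R ^+ h / (2 * #|E|%:R)) = (p * n%:R ^+ 2) * (w / (2 * #|E|%:R)).
      by rewrite wE; ring.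
    by apply: ler_wpM2r => //; positivity.
  have := le_trans (le_trans H4 H3) (le_trans H H2).
  have -> : M%:R / 2 * (w / (2 * #|E|%:R)) = 2 * (M%:R / (8 * #|E|%:R)) * w.
    by field; rewrite gt_eqF.
  have -> : #|G :&: Z|%:R * w + M%:R * (w / (8 * #|E|%:R)) =
     (#|G :&: Z|%:R + M%:R / (8 * #|E|%:R)) * w by ring.
  rewrite ler_pM2r //; lra.
Qed.

(** * Random sets with prescribed sizes, and the union bound *)

Section Sampling.
Variables (X I : finType) (Es : {set I}) (P : I -> {set X}) (M N : nat).
Hypothesis disP : forall e e' x, e \in Es -> e' \in Es ->
  x \in P e -> x \in P e' -> e = e'.
Hypothesis cardP : forall e, e \in Es -> #|P e| = N.
Implicit Types (G Q : {set X}).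

Definition ground : {set X} := \bigcup_(e in Es) P e.

Definition samples : {set {set X}} :=
  [set G : {set X} | (G \subset ground) && [forall e in Es, #|G :&: P e| == M]].

Definition through Q : {set {set X}} := [set G : {set X} in samples | Q \subset G].

Lemma tperm_stable (A : {set X}) x y : (x \in A) = (y \in A) -> tperm x y @: A = A.
Proof.
move=> xy; apply/eqP; rewrite eqEcard card_imset ?leqnn ?andbT; last exact: perm_inj.
apply/subsetP => _ /imsetP[z zA ->].
by case: tpermP zA => [->|->|//]; rewrite xy.
Qed.

(** Exchanging two elements of the same class is a symmetry of the sample space. *)
Lemma through_swap e x y Q : e \in Es -> x \in P e -> y \in P e ->
  x \notin Q -> y \notin Q -> (#|through (x |: Q)| <= #|through (y |: Q)|)%N.
Proof.
move=> eE xP yP xQ yQ; pose s := tperm x y.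
have sinj : injective (fun G : {set X} => s @: G) by apply/imset_inj/perm_inj.
rewrite -(card_imset _ sinj); apply/subset_leq_card/subsetP => _ /imsetP[G GQ ->].
have sP e' : e' \in Es -> s @: P e' = P e'.
  move=> e'E; apply: tperm_stable; apply/idP/idP => [xP'|yP'].
    by rewrite -(disP eE e'E xP xP').
  by rewrite -(disP eE e'E yP yP').
move: GQ => /setIdP[/setIdP[/subsetP GE /forall_inP GM] QG].
apply/setIdP; split; first (apply/setIdP; split).
- apply/subsetP => _ /imsetP[z /GE /bigcupP[e' e'E zP] ->].
  by apply/bigcupP; exists e' => //; rewrite -(sP e' e'E) imset_f.
- apply/forall_inP => e' e'E.
  rewrite -(sP e' e'E) -imsetI; last by move=> ? ? _ _; apply: perm_inj.
  by rewrite card_imset ?GM //; apply: perm_inj.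
- have -> : y |: Q = s @: (x |: Q).
    rewrite imsetU1 tpermL tperm_stable //.
    by rewrite (negbTE xQ) (negbTE yQ).
  exact: imsetS.
Qed.

(** By symmetry the count is the same for all [x] in [P e :\: Q]; the average over
these [x] is obtained by counting the elements of [P e :\: Q] in each sample. *)
Lemma through_step e x Q : e \in Es -> x \in P e -> x \notin Q ->
  (N * #|through (x |: Q)| <= M * #|through Q|)%N.
Proof.
move=> eE xP xQ; set a := #|through (x |: Q)|; set A := #|through Q|.
have aA : (a <= A)%N.
  apply/subset_leq_card/subsetP => G /setIdP[GS QG].
  by apply/setIdP; split=> //; apply: subset_trans QG; apply: subsetUr.
have sum : (#|P e :\: Q| * a <= \sum_(G in through Q) #|(G :&: P e) :\: Q|)%N.
  rewrite -sum_nat_const.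
  apply: (@leq_trans (\sum_(y in P e :\: Q) #|through (y |: Q)|)).
    by apply: leq_sum => y /setDP[yP yQ]; apply: (through_swap eE).
  under eq_bigr => y _ do rewrite -sum1dep_card.
  rewrite (exchange_big_dep (mem (through Q))) /=; last first.
    move=> y G _ /andP[GS]; rewrite subUset => /andP[_ QG]; exact/setIdP.
  apply: leq_sum => G _; rewrite sum1dep_card; apply/subset_leq_card/subsetP => y.
  rewrite !inE => /andP[/andP[yQ yP] /andP[_]].
  by rewrite subUset sub1set => /andP[yG _]; rewrite yQ yP yG.
have eachG G : G \in through Q -> #|(G :&: P e) :\: Q| = (M - #|P e :&: Q|)%N.
  case/setIdP => /setIdP[_ /forall_inP/(_ e eE)/eqP GM] QG.
  by rewrite cardsD GM setIAC (setIidPr QG) setIC.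
rewrite (eq_bigr _ eachG) sum_nat_const cardsD cardP // -/A in sum.
have qN : (#|P e :&: Q| <= N)%N by rewrite -(cardP eE) subset_leq_card ?subsetIl.
have [A0|/card_gt0P[G GQ]] := posnP A.
  by move: aA; rewrite A0 leqn0 => /eqP->; rewrite !muln0.
have qM : (#|P e :&: Q| <= M)%N.
  case/setIdP: GQ => /setIdP[_ /forall_inP/(_ e eE)/eqP <-] QG.
  by rewrite setIC subset_leq_card // setSI.
nia.
Qed.

(** The elements of a random sample are negatively correlated: the probability of
containing [Q] is at most [(M / N) ^ #|Q|]. *)
Lemma through_bound Q : Q \subset ground ->
  (N ^ #|Q| * #|through Q| <= M ^ #|Q| * #|samples|)%N.
Proof.
elim: {Q}#|Q| {-2}Q (erefl #|Q|) => [|k IH] Q cQ QE.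
  rewrite cQ !expn0 !mul1n; apply/subset_leq_card/subsetP => G.
  by case/setIdP.
have [x xQ] : exists x, x \in Q by apply/card_gt0P; rewrite cQ.
have [e eE xP] := bigcupP (subsetP QE x xQ).
have xNQ : x \notin Q :\ x by rewrite !inE eqxx.
have cQ' : #|Q :\ x| = k by move: cQ; rewrite (cardsD1 x) xQ => -[].
have := through_step eE xP xNQ; rewrite setD1K // => step.
have {}IH := IH _ cQ' (subset_trans (subD1set _ _) QE).
rewrite cQ' in IH; rewrite cQ !expnS.
rewrite [leqLHS](_ : _ = N ^ k * (N * #|through Q|))%N; last by ring.
apply: leq_trans (_ : N ^ k * (M * #|through (Q :\ x)|) <= _)%N.
  by rewrite leq_mul2l step orbT.
by rewrite mulnCA -mulnA leq_mul2l IH orbT.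
Qed.

End Sampling.

Lemma sum_powerset (R : comNzRingType) (X : finType) (Z : {set X}) (y : R) :
  \sum_(A : {set X} | A \subset Z) y ^+ #|A| = (1 + y) ^+ #|Z|.
Proof.
rewrite -prodr_const.
transitivity (\prod_x ((if x \in Z then y else 0) + 1)).
  rewrite bigA_distr big_mkcond /=; apply: eq_bigr => A _.
  rewrite -big_mkcond /=; case: ifP => [AZ|/subsetPn[x xA xZ]].
    rewrite -prodr_const; apply: eq_bigr => x xA.
    by rewrite (subsetP AZ).
  by rewrite (bigD1 x) //= (negbTE xZ) mul0r.
rewrite [RHS]big_mkcond /=; apply: eq_bigr => x _.
by case: ifP; rewrite ?add0r 1?addrC.
Qed.

Lemma sum_powerset_le (R : realType) (X : finType) (Z : {set X}) (y : R) :
  0 <= y -> \sum_(A : {set X} | A \subset Z) y ^+ #|A| <= expR (y * #|Z|%:R).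
Proof.
move=> y0; rewrite sum_powerset mulrC expRM_natl.
apply: lerXn2r; rewrite ?nnegrE ?expR_ge0 ?addr_ge0 //.
exact: expR_ge1Dx.
Qed.

(** Rescaling the weights by [y >= 1] costs [y ^ u] on sets of size at most [u], and
then all subsets may be summed. *)
Lemma small_sets_weight (R : realType) (X : finType) (Z : {set X}) (x y : R) u :
  0 <= x -> 1 <= y ->
  \sum_(A : {set X} | (A \subset Z) && (#|A| <= u)%N) x ^+ #|A|
    <= y ^+ u * expR (x / y * #|Z|%:R).
Proof.
move=> x0 y1; have y0 : 0 < y by apply: lt_le_trans y1.
apply: le_trans (_ : y ^+ u * \sum_(A : {set X} | A \subset Z) (x / y) ^+ #|A| <= _); last first.
  by apply: ler_wpM2l; [positivity|apply: sum_powerset_le; positivity].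
rewrite mulr_sumr big_mkcondr /=; apply: ler_sum => A _; case: ifP => Au.
  rewrite expr_div_n mulrA ler_pdivlMr ?exprn_gt0 // mulrC.
  by apply: ler_wpM2r; [positivity|apply: ler_weXn2l].
by positivity.
Qed.

(** The same device with [z] large: the sum over sets of size exactly [b] gains
a factor [z ^- b]. *)
Lemma fixed_size_weight (R : realType) (X : finType) (Z : {set X}) (x z : R) b :
  0 <= x -> 0 < z ->
  \sum_(A : {set X} | (A \subset Z) && (#|A| == b)) x ^+ b
    <= z ^- b * expR (z * x * #|Z|%:R).
Proof.
move=> x0 z0.
apply: le_trans (_ : z ^- b * \sum_(A : {set X} | A \subset Z) (z * x) ^+ #|A| <= _); last first.
  by apply: ler_wpM2l; [positivity|apply: sum_powerset_le; positivity].
rewrite mulr_sumr big_mkcondr /=; apply: ler_sum => A _; case: ifP => [/eqP<-|_].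
  by rewrite exprMn mulKf // expf_neq0 // gt_eqF.
by positivity.
Qed.

Lemma subset_of_size (X : finType) (A : {set X}) b : (b <= #|A|)%N ->
  exists2 Q : {set X}, Q \subset A & #|Q| = b.
Proof.
case/card_geqP => s [us szs sA]; exists [set x in s].
  by apply/subsetP => x; rewrite inE => /sA.
by rewrite cardsE (card_uniqP us).
Qed.

Lemma card_bigcup_seq (X : finType) (G : {set X}) (t : nat) (Ts : seq {set X}) :
  bounded_parts G t Ts -> (#|\bigcup_(T <- Ts) T| <= size Ts * t)%N.
Proof.
move=> bTs; apply: leq_trans (_ : \sum_(T <- Ts) #|T| <= _)%N.
  elim/big_rec2: _ => [|T a B _ H]; rewrite ?cards0 // cardsU leq_subLR.
  by rewrite (leq_trans _ (leq_addl _ _)) // leq_add2l.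
rewrite -sum1_size big_distrl /= big_seq [leqRHS]big_seq.
by apply: leq_sum => T /bTs[_]; rewrite mul1n.
Qed.

(** The sum runs over the union [U] of the fingerprints, the ways of writing [U] as a
union of [L] sets, at most [(2 ^ #|U|) ^ L] in number, and the [b] further elements
[Q] in the set determined by the fingerprints. Such a pair lies in a sample with
probability at most [p ^ (#|U| + b)], because [U] and [Q] are disjoint. *)
Lemma fingerprint_union_bound (R : realType) (X : finType) (E : {set X})
    (Om Bad : {set {set X}}) (p : R) (M L t b : nat)
    (Z : seq {set X} -> {set X}) (y z : R) :
    0 <= p -> 1 <= y -> 0 < z ->
    (forall Q : {set X}, Q \subset E ->
       #|[set G : {set X} in Om | Q \subset G]|%:R <= p ^+ #|Q| * #|Om|%:R) ->
    (forall Ts, Z Ts \subset E) ->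
    p * #|E|%:R <= y * M%:R -> (forall Ts, size Ts = L -> z * (p * #|Z Ts|%:R) <= M%:R) ->
    (forall G, G \in Bad -> [/\ G \in Om, G \subset E & exists Ts, [/\ size Ts = L,
       bounded_parts G t Ts & (b <= #|(G :&: Z Ts) :\: \bigcup_(T <- Ts) T|)%N]]) ->
  #|Bad|%:R <= (2 ^+ L * y) ^+ (L * t) * z ^- b * expR M%:R ^+ 2 * #|Om|%:R.
Proof.
move=> p0 y1 z0 thr ZE pE pZ bad.
pose seqof (f : {ffun 'I_L -> {set X}}) := [seq f i | i <- enum 'I_L].
pose thrU (U Q : {set X}) := [set G : {set X} in Om | U :|: Q \subset G].
pose okU (U : {set X}) := (U \subset E) && (#|U| <= L * t)%N.
pose okQ f (U Q : {set X}) := (Q \subset Z (seqof f) :\: U) && (#|Q| == b).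
have cover : Bad \subset \bigcup_(U | okU U)
   \bigcup_(f : {ffun 'I_L -> {set X}} | f \in ffun_on (mem (powerset U)))
   \bigcup_(Q | okQ f U Q) thrU U Q.
  apply/subsetP => G /bad[GO GE [Ts [szTs bTs bigZ]]].
  pose f := [ffun i : 'I_L => nth set0 Ts i].
  have seqf : seqof f = Ts.
    apply: (@eq_from_nth _ set0); first by rewrite size_map size_enum_ord szTs.
    move=> i; rewrite size_map size_enum_ord => iL.
    rewrite (nth_map (Ordinal iL)) ?size_enum_ord // ffunE.
    by rewrite nth_enum_ord.
  have [Q QZ cQ] := subset_of_size bigZ.
  pose U := \bigcup_(T <- Ts) T.
  have UG : U \subset G.
    by rewrite /U big_seq; elim/big_ind: _ => [|A B|T /bTs[]] //;
      [exact: sub0set|rewrite subUset => -> ->].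
  have TU T : T \in Ts -> T \subset U by move=> TT; rewrite /U (big_rem T) //= subsetUl.
  apply/bigcupP; exists U.
    rewrite /okU (subset_trans UG GE) /=.
    by rewrite -szTs; apply: card_bigcup_seq bTs.
  apply/bigcupP; exists f.
    apply/ffun_onP => i; rewrite ffunE inE; apply: TU.
    by rewrite mem_nth // szTs.
  apply/bigcupP; exists Q.
    rewrite /okQ seqf cQ eqxx andbT; apply: subset_trans QZ _.
    by apply: setSD; apply: subsetIr.
  rewrite inE GO subUset UG /=; apply: subset_trans QZ _.
  by apply: subset_trans (subsetDl _ _) (subsetIl _ _).
have := subset_leq_card cover; rewrite -(ler_nat R) => /le_trans; apply.
set Qw := z ^- b * expR M%:R.
have Qw0 : 0 <= Qw by rewrite /Qw; positivity.
have perU U : okU U -> #|\bigcup_(f : {ffun 'I_L -> {set X}} | f \in ffun_on (mem (powerset U)))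
   \bigcup_(Q | okQ f U Q) thrU U Q|%:R
    <= 2 ^+ L ^+ (L * t) * Qw * #|Om|%:R * p ^+ #|U|.
  move=> /andP[UE cU].
  apply: (@le_trans _ _ (\sum_(f : {ffun 'I_L -> {set X}} | f \in ffun_on (mem (powerset U)))
     Qw * #|Om|%:R * p ^+ #|U|)); last first.
    rewrite sumr_const card_ffun_on card_ord card_powerset -[leLHS]mulr_natl.
    rewrite !mulrA; do 4 (apply: ler_wpM2r; first by positivity).
    rewrite -expnM natrX -exprM; apply: ler_weXn2l; first by rewrite ler1n.
    by rewrite mulnC leq_mul2l cU orbT.
  apply: le_trans (_ : (\sum_(f : {ffun 'I_L -> {set X}} | f \in ffun_on (mem (powerset U)))
     #|\bigcup_(Q | okQ f U Q) thrU U Q|)%:R <= _).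
    by rewrite ler_nat leq_card_bigcup.
  rewrite natr_sum; apply: ler_sum => f _.
  apply: le_trans (_ : (\sum_(Q | okQ f U Q) #|thrU U Q|)%:R <= _).
    by rewrite ler_nat leq_card_bigcup.
  rewrite natr_sum.
  apply: (@le_trans _ _ (\sum_(Q | okQ f U Q) (p ^+ b) * (#|Om|%:R * p ^+ #|U|))).
    apply: ler_sum => Q /andP[QZ /eqP cQ].
    have UQE : U :|: Q \subset E.
      by rewrite subUset UE (subset_trans QZ) // (subset_trans (subsetDl _ _)).
    apply: le_trans (thr _ UQE) _.
    have -> : #|U :|: Q| = (#|U| + b)%N.
      rewrite cardsU disjoint_setI0 ?cards0 ?subn0 ?cQ //.
      apply: disjointWr QZ _; rewrite -setI_eq0; apply/eqP/setP => x.
      by rewrite !inE; case: (x \in U).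
    by rewrite exprD le_eqVlt; apply/orP; left; apply/eqP; ring.
  rewrite -mulr_suml -mulrA; apply: ler_wpM2r; first by positivity.
  apply: le_trans (_ : \sum_(Q : {set X} | (Q \subset Z (seqof f)) && (#|Q| == b)) p ^+ b <= _).
    rewrite big_mkcond [leRHS]big_mkcond /=; apply: ler_sum => Q _; rewrite /okQ.
    case: ifP => [/andP[QZ ->]|_]; last by case: ifP => // _; positivity.
    by rewrite (subset_trans QZ (subsetDl _ _)).
  apply: le_trans (fixed_size_weight _ _ p0 z0) _.
  apply: ler_wpM2l; first by positivity.
  by rewrite ler_expR -mulrA pZ // size_map size_enum_ord.
apply: le_trans (_ : (\sum_(U | okU U) #|\bigcup_(f : {ffun 'I_L -> {set X}} | f \in ffun_on (mem (powerset U)))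
   \bigcup_(Q | okQ f U Q) thrU U Q|)%:R <= _).
  by rewrite ler_nat leq_card_bigcup.
rewrite natr_sum.
apply: (@le_trans _ _ (\sum_(U | okU U) 2 ^+ L ^+ (L * t) * Qw * #|Om|%:R * p ^+ #|U|)).
  by apply: ler_sum => U /perU.
rewrite -mulr_sumr.
have := small_sets_weight E (L * t) p0 y1 => H.
have y0 : 0 < y by apply: lt_le_trans y1.
have {}H : \sum_(U | okU U) p ^+ #|U| <= y ^+ (L * t) * expR M%:R.
  apply: le_trans H _; apply: ler_wpM2l; first by positivity.
  by rewrite ler_expR mulrAC ler_pdivrMr // [M%:R * y]mulrC.
have c0 : 0 <= 2 ^+ L ^+ (L * t) * Qw * #|Om|%:R by positivity.
apply: le_trans (ler_wpM2l c0 H) _.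
rewrite /Qw exprMn le_eqVlt; apply/orP; left; apply/eqP; ring.
Qed.

(** * Codegrees and the density [m(H)] *)

Section EdgeDensity.
Variables (R : realType) (h : nat) (H : sgraph 'I_h).

Lemma edge_card (e : {set 'I_h}) : e \in edges H -> #|e| = 2%N.
Proof. by case: H => E /= /forall_inP HE /HE /eqP. Qed.

Lemma two_edges_cover (J : {set {set 'I_h}}) : J \subset edges H ->
  (1 < #|J|)%N -> (2 < #|cover J|)%N.
Proof.
move=> /subsetP JE J1; rewrite ltnNge; apply/negP => small.
have all_cover e : e \in J -> e = cover J.
  move=> eJ; apply/eqP; rewrite eqEcard (edge_card (JE e eJ)) small andbT.
  exact: bigcup_sup.
have : (#|J| <= #|[set cover J]|)%N.
  by apply/subset_leq_card/subsetP => e /all_cover eJ; rewrite inE; apply/eqP.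
by rewrite cards1 leqNgt J1.
Qed.

Lemma mdens_ge (J : {set {set 'I_h}}) : J \subset edges H -> (1 < #|J|)%N ->
  (#|J|%:R - 1) / (#|cover J|%:R - 2) <= mdens R H.
Proof.
move=> JE J1; rewrite /mdens.
apply: (le_bigmax_cond _ (fun K : {set 'I_h} * {set {set 'I_h}} =>
  (#|K.2|%:R - 1) / (#|K.1|%:R - 2)) (j := (cover J, J))).
rewrite /is_subgraph /= JE J1 andbT.
by apply/forall_inP => e eJ; apply: bigcup_sup.
Qed.

Hypothesis e2 : (2 <= nedges H)%N.

(** This lower bound makes the exponent [2 - 1 / m(H)] nonnegative, so that the
hypothesis on [M] forces [M] to be large. *)
Lemma mdens_ge_half : 1 / 2 <= mdens R H.
Proof.
apply: le_trans (mdens_ge (subxx (edges H)) e2).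
have c2 := two_edges_cover (subxx _) e2.
have cle : (#|cover (edges H)| <= #|edges H| * 2)%N.
  rewrite -sum_nat_const; apply: leq_trans (leq_card_bigcup _ _) _.
  by apply: leq_sum => e /edge_card ->.
have c2R : 2 < #|cover (edges H)|%:R :> R by rewrite ltr_nat.
have cleR : #|cover (edges H)|%:R <= #|edges H|%:R * 2 :> R.
  by rewrite -natrM ler_nat.
rewrite ler_pdivlMr ?subr_gt0 //; lra.
Qed.

Lemma mdens_gt0 : 0 < mdens R H.
Proof. by apply: lt_le_trans mdens_ge_half; lra. Qed.

(** For [J] with at least two edges, [(#|J| - 1) / m(H) <= #|cover J| - 2] by definition
of [m(H)]; for a single edge both sides are equal to [n ^ (h - 2)]. *)
Lemma codegree_bound (n : nat) (tau : R) (J : {set {set 'I_h}}) :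
    (0 < n)%N -> J \subset edges H -> J != set0 ->
    n%:R `^ (- (1 / mdens R H)) <= tau ->
  (n ^ (h - #|cover J|))%:R <= tau ^+ #|J|.-1 * n%:R ^+ (h - 2).
Proof.
move=> n0 JE J0 tau_ge; have nR1 : 1 <= n%:R :> R by rewrite ler1n.
have nR0 : 0 < n%:R :> R by rewrite ltr0n.
have m0 := mdens_gt0.
have [J1|J1] := leqP #|J| 1.
  have /cards1P[e Je] : #|J| == 1%N by rewrite eqn_leq J1 card_gt0.
  rewrite Je cover1 cards1 expr0 mul1r natrX.
  by rewrite edge_card // (subsetP JE) // Je inE.
have c2 := two_edges_cover JE J1; set v := #|cover J| in c2 *.
have vh : (v <= h)%N by rewrite -[leqRHS]card_ord max_card.
have ge := mdens_ge JE J1; rewrite -/v in ge.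
have c2R : 2 < v%:R :> R by rewrite ltr_nat.
have kv : #|J|.-1%:R / mdens R H <= (v - 2)%:R.
  rewrite ler_pdivrMr // natrB; last exact: ltnW.
  rewrite ler_pdivrMr ?subr_gt0 // in ge.
  by rewrite -subn1 natrB ?(ltnW J1) // mulrC.
have -> : (h - 2 = (h - v) + (v - 2))%N by lia.
rewrite natrX exprD mulrCA ler_peMr ?exprn_ge0 //.
apply: (@le_trans _ _ (n%:R `^ (- (1 / mdens R H)) ^+ #|J|.-1 * n%:R ^+ (v - 2))).
  rewrite -powR_mulrn ?powR_ge0 // -powRrM -powR_mulrn //.
  rewrite -powRD; last by apply/implyP => _; rewrite gt_eqF.
  rewrite -[leLHS](powRr0 n%:R) ler_powR // mulNr mul1r [_^-1 * _]mulrC.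
  by rewrite addrC subr_ge0.
apply: ler_wpM2r; first by positivity.
by apply: lerXn2r; rewrite ?nnegrE ?powR_ge0 // (le_trans _ tau_ge) // powR_ge0.
Qed.

End EdgeDensity.

(** * From graphs to sets of pairs *)

Section Parts.
Variables (T : finType) (h n : nat) (V : 'I_h -> {set T}).
Hypotheses (cardV : forall l, #|V l| = n) (n_gt0 : (0 < n)%N).
Hypothesis disV : forall l l' y, y \in V l -> y \in V l' -> l = l'.

Lemma disjoint_parts i j (U W : {set T}) : i != j -> U \subset V i ->
  W \subset V j -> [disjoint U & W].
Proof.
move=> ij /subsetP sU /subsetP sW; rewrite -setI_eq0; apply/eqP/setP => x.
rewrite !inE; apply/negP => /andP[/sU xi /sW xj].
by rewrite (disV xi xj) eqxx in ij.
Qed.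

Lemma part_pairP i j x : i != j ->
  reflect (exists u w, [/\ u \in V i, w \in V j & x = [set u; w]])
          (x \in part V [set i; j]).
Proof.
move=> ij; apply: (iffP imsetP) => [[v /boxP vV ->]|[u [w [ui wj ->]]]].
  by exists (v i), (v j); rewrite imset_pair.
have pick l : exists y, y \in V l by apply/card_gt0P; rewrite cardV.
have [d dV] := choice pick.
exists [ffun l => if l == i then u else if l == j then w else d l].
  apply/boxP => l; rewrite ffunE.
  by case: eqVneq => [->//|_]; case: eqVneq => [->|].
by rewrite imset_pair !ffunE eqxx eq_sym (negbTE ij) eqxx.
Qed.

Lemma pair_set_inj (U W : {set T}) x y x' y' : [disjoint U & W] ->
  x \in U -> x' \in U -> y \in W -> y' \in W ->
  [set x; y] = [set x'; y'] -> x = x' /\ y = y'.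
Proof.
move=> /pred0P dis xU x'U yW y'W eq.
have no z : z \in U -> z \in W -> False.
  by move=> zU zW; have := dis z; rewrite /= zU zW.
split.
  have := set21 x y; rewrite eq => /set2P[//|xy'].
  by case: (no x) => //; rewrite xy'.
have := set22 x y; rewrite eq => /set2P[yx'|//].
by case: (no y) => //; rewrite yx'.
Qed.

Lemma edges_between_pair_count (G : sgraph T) (U W : {set T}) :
  [disjoint U & W] -> edges_between G U W = pair_count (edges G) U W.
Proof.
move=> dis; rewrite /pair_count pair_big /=.
have -> : (\sum_(p | (p.1 \in U) && (p.2 \in W)) ([set p.1; p.2] \in edges G) =
   #|[set p in setX U W | [set p.1; p.2] \in edges G]|)%N.
  rewrite -sum1dep_card [RHS]big_mkcondr /=; apply: eq_big => p; rewrite ?inE //.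
rewrite -(card_in_imset (f := fun p : T * T => [set p.1; p.2])) /=.
  rewrite /edges_between; congr #|pred_of_set _|; apply/setP => e.
  apply/setIdP/imsetP => [[eG /exists_inP[x xU /exists_inP[y yW /eqP exy]]]|].
    by exists (x, y); rewrite // !inE xU yW -exy.
  move=> [[x y]]; rewrite !inE /= => /andP[/andP[xU yW] xyG] ->; split=> //.
  by apply/exists_inP; exists x => //; apply/exists_inP; exists y.
move=> [x y] [x' y']; rewrite !inE /= => /andP[/andP[xU yW] _] /andP[/andP[x'U y'W] _].
by move=> /(pair_set_inj dis xU x'U yW y'W)[-> ->].
Qed.

Lemma edges_between_parts (G : sgraph T) i j : i != j ->
  edges_between G (V i) (V j) = #|edges G :&: part V [set i; j]|.
Proof.
move=> ij; rewrite /edges_between; congr #|pred_of_set _|; apply/setP => e.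
rewrite !inE; congr (_ && _); apply/idP/(part_pairP _ ij).
  move=> /exists_inP[x xU /exists_inP[y yW /eqP exy]].
  by exists x, y.
move=> [x [y [xU yW ->]]].
by apply/exists_inP; exists x => //; apply/exists_inP; exists y.
Qed.

Lemma card_part (e : {set 'I_h}) : #|e| = 2%N -> #|part V e| = (n ^ 2)%N.
Proof.
move=> /eqP/cards2P[i [j [ij ->]]].
have dis := disjoint_parts ij (subxx _) (subxx _).
rewrite -[RHS]/(n * n)%N -{1}(cardV i) -(cardV j) -cardsX.
rewrite -(card_in_imset (f := fun p : T * T => [set p.1; p.2])) /=.
  congr #|pred_of_set _|; apply/setP => e0.
  apply/(part_pairP _ ij)/imsetP => [[u [w [ui wj ->]]]|[[u w]]].
    by exists (u, w); rewrite // !inE ui.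
  by rewrite !inE /= => /andP[ui wj] ->; exists u, w.
move=> [x y] [x' y']; rewrite !inE /= => /andP[xU yW] /andP[x'U y'W].
by move=> /(pair_set_inj dis xU x'U yW y'W)[-> ->].
Qed.

Lemma part_inj (e e' : {set 'I_h}) x : x \in part V e -> x \in part V e' -> e = e'.
Proof.
move=> /imsetP[v /boxP vV xv] /imsetP[v' /boxP v'V xv'].
have sub (a b : {set 'I_h}) (s s' : {ffun 'I_h -> T}) :
    (forall l, s l \in V l) -> (forall l, s' l \in V l) ->
    s @: a = s' @: b -> a \subset b.
  move=> sV s'V eq; apply/subsetP => l la.
  have : s l \in s' @: b by rewrite -eq imset_f.
  case/imsetP => l' l'b sl.
  by have := sV l; rewrite sl => /disV/(_ (s'V l')) ->.
apply/eqP; rewrite eqEsubset; apply/andP; split.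
  by apply: (sub _ _ v v'); rewrite -?xv.
by apply: (sub _ _ v' v); rewrite -?xv.
Qed.

End Parts.

Section Transfer.
Variables (h n : nat) (H : sgraph 'I_h) (V : 'I_h -> {set 'I_(h * n)}) (M : nat).
Hypotheses (eqV : equipartition V) (n_gt0 : (0 < n)%N).

Lemma equipartition_card l : #|V l| = n.
Proof. by case: eqV. Qed.

Lemma equipartition_inj l l' y : y \in V l -> y \in V l' -> l = l'.
Proof.
case: eqV => _ dis _ yl yl'; apply/eqP/negP => /negP ll'.
by have /pred0P/(_ y) := dis _ _ ll'; rewrite /= yl yl'.
Qed.

Let cV := equipartition_card.
Let dV := equipartition_inj.

(** The pairs of an [h]-partite graph lie in the classes of the edges of [H] because
the other pairs of parts span no edges. *)
Lemma partite_graphsE (G : sgraph 'I_(h * n)) :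
  (G \in partite_graphs H V M) = (edges G \in samples (edges H) (part V) M).
Proof.
have EH (i j : 'I_h) : [set i; j] \in edges H -> i != j.
  move=> /edge_card; apply: contra_eqN => /eqP->.
  by rewrite setUid cards1.
apply/setIdP/setIdP => [[Gp Gb]|[/subsetP GE /forall_inP GM]].
  have {}Gb i j : i != j -> #|edges G :&: part V [set i; j]| =
      if adj H i j then M else 0%N.
    move=> ij; rewrite -(edges_between_parts cV n_gt0) //.
    by have /forallP/(_ j)/implyP/(_ ij)/eqP := forallP Gb i.
  split; last first.
    apply/forall_inP => e eE; have := eE.
    have /eqP/cards2P[i [j [ij ->]]] := edge_card eE => ijE.
    by rewrite Gb // /adj ijE.
  apply/subsetP => x xG.
  have x2 : #|x| = 2%N by case: {Gp Gb} G xG => E /= /forall_inP HE /HE /eqP.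
  have /eqP/cards2P[u [w [uw xE]]] := x2.
  have colour y : exists l, y \in V l.
    case: eqV => cov _ _; have : y \in \bigcup_(i < h) V i by rewrite cov inE.
    by case/bigcupP => l _; exists l.
  have [i ui] := colour u; have [j wj] := colour w.
  have ij : i != j.
    apply/eqP => ij; rewrite -ij in wj.
    have /forall_inP/(_ x xG)/forallP/(_ i) := Gp.
    rewrite (setIidPl _) ?x2 // xE; apply/subsetP => z /set2P[->|->] //.
  have xij : x \in part V [set i; j] by apply/(part_pairP cV n_gt0) => //; exists u, w.
  have := Gb i j ij; case: ifP => [ijE _|_ /eqP].
    by apply/bigcupP; exists [set i; j].
  by rewrite cards_eq0 => /eqP/setP/(_ x); rewrite !inE xG xij.
split.
  apply/forall_inP => x /GE/bigcupP[e eE /imsetP[v /boxP vV ->]].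
  apply/forallP => i; rewrite leqNgt; apply/negP => /card_gt1P[y [z []]].
  case/setIP => /imsetP[l le ->] vl /setIP[/imsetP[l' l'e ->] vl'].
  by rewrite (_ : l = l') ?eqxx // (dV (vV l) vl) (dV (vV l') vl').
apply/forallP => i; apply/forallP => j; apply/implyP => ij.
rewrite (edges_between_parts cV n_gt0) //; case: ifP => [ijE|ijE].
  by rewrite GM.
rewrite cards_eq0; apply/eqP/setP => x; rewrite !inE; apply/negP => /andP[/GE].
move=> /bigcupP[e eE xe] xij.
by move: ijE; rewrite /adj (part_inj dV xij xe) eE.
Qed.

Lemma canonical_copiesE (G : sgraph 'I_(h * n)) :
  canonical_copies H V G =
  copies_in (fun (e : {set 'I_h}) (v : {ffun 'I_h -> 'I_(h * n)}) => v @: e)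
    (box V) (enum (edges H)) (edges G).
Proof.
apply/setP => v; rewrite !inE; congr (_ && _); apply/idP/allP => [vG e|vG].
  rewrite mem_enum => eE; have := eE.
  have /eqP/cards2P[i [j [ij ->]]] := edge_card eE => ijE.
  rewrite imset_pair.
  by have /forallP/(_ j)/implyP/(_ ijE) := forallP vG i.
apply/forallP => i; apply/forallP => j; apply/implyP => ijE.
by rewrite /adj -imset_pair vG // mem_enum.
Qed.

Lemma regular_lower_dense (R : realType) (c kappa : R) (G : sgraph 'I_(h * n)) :
    2 <= c -> 1 / c <= kappa ->
    regular_graph H V (1 / c) (M%:R / n%:R ^+ 2) G ->
    G \in partite_graphs H V M ->
  lower_dense (edges H) V n kappa (M%:R / n%:R ^+ 2 / 2) (edges G).
Proof.
move=> c2 ck reg GM i j U W ij ijE sU sW bU bW.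
have c0 : 0 < c by lra.
have nR0 : 0 < n%:R :> R by rewrite ltr0n.
set p := M%:R / n%:R ^+ 2; have p0 : 0 <= p by rewrite /p; positivity.
have dens : density R G (V i) (V j) = p.
  rewrite /density !cV (edges_between_parts cV n_gt0) //.
  have : edges G \in samples (edges H) (part V) M by rewrite -partite_graphsE.
  case/setIdP => _ /forall_inP/(_ _ ijE)/eqP ->.
  by rewrite /p expr2.
have /forallP/(_ j)/implyP/(_ ijE) := forallP reg i.
move=> /forallP/(_ U)/forallP/(_ W)/implyP.
rewrite sU sW !cV /=.
have large (A : {set 'I_(h * n)}) : 
    kappa * n%:R <= #|A|%:R -> 1 / c * n%:R <= #|A|%:R.
  by apply: le_trans; rewrite ler_wpM2r.
rewrite !large // => /(_ isT); rewrite dens -/p ler_norml => /andP[lo _].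
rewrite -edges_between_pair_count; last exact: (disjoint_parts dV ij).
have [UW0|UW0] := eqVneq (#|U|%:R * #|W|%:R : R) 0; first by rewrite UW0 mulr0.
have UWp : 0 < #|U|%:R * #|W|%:R :> R by rewrite lt_def UW0 mulr_ge0.
rewrite -ler_pdivlMr //; rewrite -/(density R G U W).
have : 1 / c * p <= 1 / 2 * p.
  by apply: ler_wpM2r => //; rewrite !div1r lef_pV2 // posrE.
lra.
Qed.

End Transfer.

(** * The theorem *)

Lemma sparse_container_hit (X : finType) (G C Z : {set X}) (Ts : seq {set X})
    (t b : nat) :
    bounded_parts G t Ts -> (b + size Ts * t <= #|G :&: Z|)%N ->
    (forall x, x \in Z -> x \in G -> (forall T, T \in Ts -> x \notin T) -> x \in C) ->
  (b <= #|(G :&: (C :&: Z)) :\: \bigcup_(T <- Ts) T|)%N.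
Proof.
move=> bTs big inC; set U := \bigcup_(T <- Ts) T.
have cU : (#|U| <= size Ts * t)%N by apply: card_bigcup_seq bTs.
have : (b <= #|(G :&: Z) :\: U|)%N.
  rewrite cardsD leq_subRL; last exact/subset_leq_card/subsetIl.
  apply: leq_trans big; rewrite addnC leq_add2l; apply: leq_trans cU.
  exact/subset_leq_card/subsetIr.
move/leq_trans; apply; apply/subset_leq_card/subsetP => x.
rewrite !inE => /andP[xU /andP[xG xZ]]; rewrite xU xG xZ !andbT /=.
apply: inC => // T TT; apply: contra xU => xT.
by rewrite /U (big_rem T) //= inE xT.
Qed.

Lemma quarter_split (q x y M : nat) : (x * (16 * q) <= M)%N ->
  (32 * q * y <= M)%N -> (32 * q <= M)%N -> ((x.+1 + y) * (8 * q) <= M)%N.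
Proof.
have -> : ((x.+1 + y) * (8 * q) = 8 * (x * q) + 8 * q + 8 * (q * y))%N by ring.
have -> : (x * (16 * q) = 16 * (x * q))%N by ring.
have -> : (32 * q * y = 32 * (q * y))%N by ring.
lia.
Qed.

(** The constants: [8 q rho = a ^ (16 q)] turns the gain of [b > M / (16 q)] forced
edges into [a ^ M], and [D] makes [t = M %/ D] so small that the fingerprints cost
at most [2 ^ M] and contain at most a quarter of the [M / (8 q)] edges in the level
set. *)
Lemma few_bad_samples (R : realType) (h : nat) (H : sgraph 'I_h)
    (a : R) : (2 <= nedges H)%N -> 0 < a -> a <= 1 ->
  exists2 D : nat, (0 < D)%N & exists2 beta : R, 0 < beta & exists2 kappa : R, 0 < kappa &
  forall (n : nat) (V : 'I_h -> {set 'I_(h * n)}) (M : nat) (tau : R),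
    equipartition V -> (0 < n)%N -> (D <= M)%N ->
    tau = (M %/ D)%:R / n%:R ^+ 2 -> n%:R `^ (- (1 / mdens R H)) <= tau ->
  forall Bad : {set sgraph 'I_(h * n)},
    (forall G, G \in Bad -> [/\ G \in partite_graphs H V M,
       lower_dense (edges H) V n kappa (M%:R / n%:R ^+ 2 / 2) (edges G) &
       (ncopies H V G)%:R < beta * n%:R ^+ h * tau ^+ nedges H]) ->
  #|Bad|%:R <= 2 ^+ M * a ^+ M * expR M%:R ^+ 2 * #|partite_graphs H V M|%:R.
Proof.
move=> e2 a0 a1; set E := edges H; set q := nedges H in e2 *.
have q0 : (0 < q)%N by apply: leq_trans e2.
have qR0 : 0 < q%:R :> R by rewrite ltr0n.
have E0 : E != set0 by rewrite -card_gt0.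
have h2 : (2 <= h)%N.
  have [e eE] := set0Pn _ E0.
  by rewrite -(edge_card eE) -[leqRHS]card_ord max_card.
pose rho := a ^+ (16 * q) / (8 * q%:R).
have rho0 : 0 < rho by rewrite /rho; positivity.
have rho1 : rho <= 1.
  rewrite /rho ler_pdivrMr ?mul1r; last by positivity.
  apply: le_trans (_ : 1 <= _); first by rewrite exprn_ile1 // ltW.
  by rewrite -natrM ler1n muln_gt0.
have [eps eps0 [kappa kappa0 level]] :=
  @sparse_level_set R h E rho (@edge_card h H) E0 rho0 rho1.
have [L [beta beta0 cont]] := @containers R {set 'I_h} q eps q0 eps0.
pose K := ((L + q).+1 * L.+1)%N.
have KL : (L <= K)%N by rewrite /K (leq_trans (leqnSn L)) // leq_pmull.
have KLq : ((L + q) * L <= K)%N by rewrite /K leq_mul // ltnW.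
pose D := (32 * q * K)%N.
have D0 : (0 < D)%N by rewrite /D !muln_gt0 q0.
exists D => //; exists beta => //; exists kappa => // n V M tau eqV n0 DM tauE tau_ge Bad badP.
have cV := equipartition_card eqV; have dV := equipartition_inj eqV.
have nR0 : 0 < n%:R :> R by rewrite ltr0n.
pose N := n%:R ^+ 2 : R; have N0 : 0 < N by rewrite /N; positivity.
pose w := n%:R ^+ (h - 2) : R; have w0 : 0 < w by rewrite /w; positivity.
have Nw : N * w = n%:R ^+ h by rewrite /N /w -exprD subnKC.
have M0 : (0 < M)%N by apply: leq_trans DM.
pose t := (M %/ D)%N.
have t0 : (0 < t)%N by rewrite divn_gt0.
have tN : t%:R = tau * N by rewrite tauE divfK // gt_eqF.
have tau0 : 0 < tau by rewrite tauE divr_gt0 // ltr0n.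
pose g (e : {set 'I_h}) (v : {ffun 'I_h -> 'I_(h * n)}) := v @: e.
have degV (J : {set {set 'I_h}}) s : J != set0 -> J \subset [set i in enum E] ->
    (degree g (box V) J s)%:R <= tau ^+ #|J|.-1 * w.
  move=> J0; rewrite set_enum => JE.
  apply: le_trans (codegree_bound e2 n0 JE J0 tau_ge); rewrite ler_nat.
  apply: leq_trans (extension_count cV dV J s).
  by apply/subset_leq_card/subsetP => v; rewrite !inE.
have cardg e : e \in enum E -> #|g e @: box V|%:R <= N.
  rewrite mem_enum => eE; rewrite (card_part cV n0 dV (edge_card eE)).
  by rewrite /N -natrX.
have szE : size (enum E) = q by rewrite -cardE.
have [F HF] := cont _ _ g (enum E) szE (enum_uniq _) tau w N t tau0 w0 N0 tN
  (box V) degV cardg.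
pose p : R := M%:R / n%:R ^+ 2.
have p0 : 0 <= p by rewrite /p; positivity.
have pN : p * N = M%:R by rewrite /p /N divfK // gt_eqF.
pose few (C : {set {set 'I_(h * n)}}) :=
  #|copies_in g (box V) (enum E) C|%:R < eps * N * w.
have levelC (C : {set {set 'I_(h * n)}}) : exists Z : {set {set 'I_(h * n)}}, few C ->
    [/\ exists2 e, e \in E & Z \subset part V e,
        #|C :&: Z|%:R <= 8 * q%:R * rho * N &
        forall G : {set {set 'I_(h * n)}},
          lower_dense E V n kappa (p / 2) G ->
          (forall e, e \in E -> #|G :&: part V e| = M) ->
          M%:R / (8 * q%:R) <= #|G :&: Z|%:R :> R].
  have [fC|nfC] := boolP (few C); last by exists set0.
  have [] := level _ V n C (p / 2) M cV n0 dV.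
  - by rewrite -/N; move: pN; lra.
  - by positivity.
  - rewrite -Nw mulrA; apply: le_lt_trans fC; rewrite ler_nat.
    apply/subset_leq_card/subsetP => v /setIdP[vV /forall_inP vC].
    by rewrite inE vV; apply/allP => e; rewrite mem_enum => /vC.
  move=> e eE [Z [Ze CZ GZ]]; exists Z => _; split=> //; first by exists e.
  by move=> G dG GM; apply: GZ => //; rewrite GM.
have [lev levP] := choice levelC.
pose Z Ts := if few (F Ts) then F Ts :&: lev (F Ts) else set0.
pose b := (M %/ (16 * q)).+1.
pose Gr := ground E (part V).
have ZGr Ts : Z Ts \subset Gr.
  rewrite /Z; case: ifP => [/levP[[e eE eZ] _ _]|_]; last exact: sub0set.
  apply: subset_trans (subsetIr _ _) (subset_trans eZ _).
  exact: (bigcup_sup e).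
have disP e e' x : e \in E -> e' \in E -> x \in part V e -> x \in part V e' -> e = e'.
  by move=> _ _; apply: part_inj.
have cardP e : e \in E -> #|part V e| = (n ^ 2)%N.
  by move=> /edge_card; apply: card_part.
have cGr : #|Gr|%:R <= q%:R * N :> R.
  apply: le_trans (_ : (\sum_(e in E) #|part V e|)%:R <= _).
    by rewrite ler_nat leq_card_bigcup.
  by rewrite (eq_bigr _ cardP) sum_nat_const natrM natrX.
have thr (Q : {set {set 'I_(h * n)}}) : Q \subset Gr ->
  #|[set G : {set {set 'I_(h * n)}} in samples E (part V) M | Q \subset G]|%:R
    <= p ^+ #|Q| * #|samples E (part V) M|%:R.
  move=> QGr; have := through_bound M disP cardP QGr.
  rewrite /through -(ler_nat R) !natrM !natrX => le.
  rewrite /p expr_div_n mulrAC ler_pdivlMr ?exprn_gt0 //.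
  by rewrite mulrC.
pose BadE := [set edges G | G in Bad].
have cBad : #|BadE| = #|Bad| by rewrite card_imset //; apply: val_inj.
have cOm : (#|samples E (part V) M| <= #|partite_graphs H V M|)%N.
  rewrite -(card_imset _ (val_inj : injective (@edges _))).
  apply/subset_leq_card/subsetP => B BS.
  have B2 : [forall e in B, #|e| == 2%N].
    apply/forall_inP => x xB; case/setIdP: BS => /subsetP/(_ x xB).
    case/bigcupP => e eE /imsetP[v /boxP vV ->] _.
    rewrite card_in_imset ?(edge_card eE) // => l l' _ _ vl.
    by apply: (dV l l' (v l)) => //; rewrite vl.
  apply/imsetP; exists (SGraph B2) => //.
  by rewrite (partite_graphsE H M eqV n0).
have bound : #|BadE|%:R <= (2 ^+ L * q%:R) ^+ (L * t) * (1 / (8 * q%:R * rho)) ^- b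
     * expR M%:R ^+ 2 * #|samples E (part V) M|%:R.
  apply: (@fingerprint_union_bound R _ Gr (samples E (part V) M) BadE p M L t b Z) => //.
  - by rewrite ler1n.
  - by positivity.
  - apply: le_trans (ler_wpM2l p0 cGr) _.
    by rewrite mulrCA pN.
  - move=> Ts _; have cZ : #|Z Ts|%:R <= 8 * q%:R * rho * N.
      rewrite /Z; case: ifP => [/levP[_ + _] //|_].
      by rewrite cards0; positivity.
    apply: le_trans (_ : 1 / (8 * q%:R * rho) * (p * (8 * q%:R * rho * N)) <= _).
      by do 2 (apply: ler_wpM2l; first by positivity).
    rewrite -pN le_eqVlt; apply/orP; left; apply/eqP; field.
    by rewrite (gt_eqF rho0) (gt_eqF qR0).
  - move=> _ /imsetP[G /badP[GO dG fewG] ->].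
    have GS : edges G \in samples E (part V) M by rewrite -(partite_graphsE H M eqV n0).
    have := GS; case/setIdP => GGr /forall_inP GM; split=> //.
    have [|Ts [szTs bTs fewF inF]] := HF (edges G).
      have -> : #|copies_in g (box V) (enum E) (edges G)| = ncopies H V G.
        by rewrite /ncopies canonical_copiesE.
      by rewrite [_ * w]mulrC mulrA -(mulrA beta) Nw.
    exists Ts; split=> //; rewrite /Z /few fewF.
    have [[e eE eZ] _ bigZ] := levP _ fewF.
    apply: (sparse_container_hit bTs) => [|x xZ xG notT].
      have := bigZ _ dG (fun e eE => eqP (GM e eE)).
      rewrite ler_pdivrMr; last by positivity.
      rewrite -!natrM ler_nat szTs => {}bigZ.
      rewrite -(leq_pmul2r (_ : 0 < 8 * q)%N) ?muln_gt0 ?q0 //.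
      apply: leq_trans bigZ; rewrite /b.
      have b1 : (M %/ (16 * q) * (16 * q) <= M)%N by apply: leq_trunc_div.
      have Lt : (32 * q * (L * t) <= M)%N.
        apply: leq_trans (leq_trunc_div M D); rewrite -/t.
        rewrite mulnA [leqLHS]mulnC leq_mul2l /D leq_mul2l KL !orbT //.
      have DM' : (32 * q <= M)%N.
        by apply: leq_trans DM; rewrite /D leq_pmulr // muln_gt0.
      exact: quarter_split.
    by apply: (inF e) => //; [rewrite mem_enum|apply: (subsetP eZ)].
rewrite -cBad; apply: le_trans bound _.
apply: ler_pM; rewrite ?ler_nat //; first by positivity.
apply: ler_wpM2r; first by positivity.
apply: ler_pM; [by positivity|by positivity| |].
  apply: le_trans (_ : (2 ^+ (L + q)) ^+ (L * t) <= _).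
    apply: lerXn2r; rewrite ?nnegrE; [by positivity|by positivity|].
    rewrite exprD; apply: ler_wpM2l; first by positivity.
    by rewrite -natrX ler_nat ltnW // ltn_expl.
  rewrite -exprM; apply: ler_weXn2l; first by rewrite ler1n.
  apply: leq_trans (leq_trunc_div M D); rewrite -/t.
  rewrite mulnA [leqLHS]mulnC leq_mul2l (leq_trans KLq) ?orbT // /D leq_pmull //.
  by rewrite muln_gt0 q0.
have -> : 8 * q%:R * rho = a ^+ (16 * q).
  rewrite /rho mulrC divfK // gt_eqF //; positivity.
rewrite div1r exprVn invrK -exprM; apply: ler_wiXn2l => //; first exact: ltW.
rewrite /b mulnC; apply: ltnW; rewrite -ltn_divLR ?muln_gt0 ?q0 //.
Qed.

Theorem theorem10p2 (R : realType) (h : nat) (H : sgraph 'I_h)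
    (e2 : (2 <= nedges H)%N) (alpha : R) (alpha_gt0 : 0 < alpha) :
  exists c : R, 0 < c /\
    exists n0 : nat, forall n : nat, (n0 <= n)%N ->
    forall V : 'I_h -> {set 'I_(h * n)}, equipartition V ->
    forall M : nat, (M <= n ^ 2)%N ->
      c * n%:R `^ (2 - 1 / mdens R H) <= M%:R ->
      uniform_pr R (partite_graphs H V M)
        (fun G => regular_graph H V (1 / c) (M%:R / n%:R ^+ 2) G &&
           ((ncopies H V G)%:R <=
              1 / c * n%:R ^+ h * (M%:R / n%:R ^+ 2) ^+ nedges H))
      <= alpha ^+ M.
Proof.
pose a := Num.min alpha 1 / (2 * expR 1 ^+ 2).
have min0 : 0 < Num.min alpha 1 by rewrite lt_min alpha_gt0 ltr01.
have e0 : 0 < expR 1 :> R by apply: expR_gt0.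
have e1 : 1 <= expR 1 :> R.
  by apply: le_trans (expR_ge1Dx 1); rewrite lerDl.
have a0 : 0 < a by rewrite /a; positivity.
have a1 : a <= 1.
  rewrite /a ler_pdivrMr ?mul1r; last by positivity.
  apply: le_trans (_ : 1 <= _); first by rewrite ge_min lexx orbT.
  have : 1 <= expR 1 ^+ 2 :> R by rewrite exprn_ege1.
  lra.
have [D D0 [beta beta0 [kappa kappa0 main]]] := few_bad_samples e2 a0 a1.
pose m := mdens R H; have m0 : 0 < m by apply: mdens_gt0.
have m2 : 1 / m <= 2.
  by rewrite ler_pdivrMr //; have := mdens_ge_half R e2; rewrite -/m; lra.
set q := nedges H in e2 main *; clearbody q.
pose DR : R := D%:R; have DR0 : 0 < DR by rewrite ltr0n.
pose c0 : R := (2 * DR) ^+ q / beta.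
have c00 : 0 < c0 by rewrite /c0; positivity.
have kV0 : 0 < 1 / kappa by positivity.
pose c := 2 + 1 / kappa + 2 * DR + c0.
have c_gt0 : 0 < c by rewrite /c; lra.
have c2 : 2 <= c by rewrite /c; lra.
have cbeta : 1 / c * (2 * DR) ^+ q < beta.
  rewrite div1r [ltLHS]mulrC ltr_pdivrMr // [ltRHS]mulrC -ltr_pdivrMr //.
  by rewrite -/c0 /c ltrDr; lra.
have ck : 1 / c <= kappa.
  by rewrite ler_pdivrMr // mulrC -ler_pdivrMr // /c; lra.
exists c; split=> //; exists 1%N => n n1 V eqV M Mn Mc.
have nR0 : 0 < n%:R :> R by rewrite ltr0n.
have nR1 : 1 <= n%:R :> R by rewrite ler1n.
have DM : (D <= M)%N.
  rewrite -(ler_nat R) -/DR; apply: le_trans Mc.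
  apply: le_trans (_ : c * 1 <= _); first by rewrite /c; lra.
  apply: ler_wpM2l; first exact: ltW.
  by rewrite -[leLHS](powRr0 n%:R) ler_powR // subr_ge0.
set p : R := M%:R / n%:R ^+ 2; set x := n%:R `^ (- (1 / m)).
have p0 : 0 <= p by rewrite /p; positivity.
have x0 : 0 <= x by apply: powR_ge0.
have pc : c * x <= p.
  rewrite ler_pdivlMr ?exprn_gt0 //; apply: le_trans Mc.
  rewrite -mulrA -powR_mulrn ?ler0n // -powRD; last by apply/implyP => _; rewrite gt_eqF.
  by rewrite addrC.
pose tau : R := (M %/ D)%:R / n%:R ^+ 2.
have tau_p : p <= 2 * DR * tau.
  rewrite /p /tau mulrA; apply: ler_wpM2r; first by positivity.
  rewrite /DR -!natrM ler_nat.
  have tpos : (0 < M %/ D)%N by rewrite divn_gt0.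
  have := ltn_ceil M D0; rewrite mulSn => /ltnW /leq_trans; apply.
  by rewrite -mulnA mul2n -addnn mulnC leq_add2r leq_pmulr.
have x_tau : x <= tau.
  rewrite -(ler_pM2l (_ : 0 < 2 * DR)); last by positivity.
  apply: le_trans tau_p; apply: le_trans pc; apply: ler_wpM2r => //.
  by rewrite /c; lra.
have tau0 : 0 <= tau by rewrite /tau; positivity.
pose Bad := [set G in partite_graphs H V M |
  regular_graph H V (1 / c) p G &&
  ((ncopies H V G)%:R <= 1 / c * n%:R ^+ h * p ^+ q)].
have taup : 0 < tau by rewrite /tau divr_gt0 ?exprn_gt0 // ltr0n divn_gt0.
have := main n V M tau eqV n1 DM erefl x_tau Bad; rewrite /uniform_pr -/Bad => H1.
have {H1} : #|Bad|%:R <= 2 ^+ M * a ^+ M * expR M%:R ^+ 2 * #|partite_graphs H V M|%:R.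
  apply: H1 => G /setIdP[GO /andP[Greg Gfew]]; split=> //.
    exact: (regular_lower_dense eqV n1 c2 ck Greg GO).
  apply: le_lt_trans Gfew _.
  apply: le_lt_trans (_ : 1 / c * n%:R ^+ h * ((2 * DR) ^+ q * tau ^+ q) < _).
    apply: ler_wpM2l; first by positivity.
    rewrite -exprMn; apply: lerXn2r; rewrite ?nnegrE //; positivity.
  rewrite [ltLHS](_ : _ = (1 / c * (2 * DR) ^+ q) * (n%:R ^+ h * tau ^+ q)).
    rewrite -[ltRHS]mulrA ltr_pM2r; last by positivity.
    exact: cbeta.
  exact: mulrACA.
have -> : 2 ^+ M * a ^+ M * expR M%:R ^+ 2 = Num.min alpha 1 ^+ M.
  have -> : expR M%:R = expR 1 ^+ M :> R by rewrite -expRM_natl mulr1.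
  rewrite exprAC -!exprMn; congr (_ ^+ M).
  by rewrite /a; field; rewrite gt_eqF.
move=> bad; have [Om0|Om0] := eqVneq #|partite_graphs H V M| 0%N.
  by rewrite Om0 invr0 mulr0 exprn_ge0 // ltW.
rewrite ler_pdivrMr ?ltr0n ?lt0n //; apply: le_trans bad _.
apply: ler_wpM2r => //; apply: lerXn2r; rewrite ?nnegrE ?(ltW min0) ?(ltW alpha_gt0) //.
by rewrite ge_min lexx.
Qed.
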